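(* Let $k>0$, $c\in\mathbb{R}$, $x>0$, and let $\alpha,\lambda,v\in\mathbb{C}$ be such that $\Re(v)>-1$, $\Re(\alpha)>0$, $\Re(\lambda+v)>0$ and $\frac{\lambda}{k}+\frac{v}{k}\notin\{0,-1,-2,\dots\}$, and suppose that none of the three lower parameters of the ${}_2F_3$ below is in $\{0,-1,-2,\dots\}$. Then $$\left(I_{0+}^{\alpha}\,t^{\frac{\lambda}{k}-1}W_{v,c}^{k}(t)\right)(x)=\frac{x^{\frac{\lambda}{k}+\frac{v}{k}+\alpha-1}}{(2k)^{\frac{v}{k}}}\,\frac{\Gamma\left(\frac{\lambda}{k}+\frac{v}{k}\right)}{\Gamma\left(\frac{\lambda}{k}+\frac{v}{k}+\alpha\right)\Gamma\left(\frac{v}{k}+1\right)}\;{}_2F_3\left[\begin{array}{c}\frac{\lambda}{2k}+\frac{v}{2k},\ \frac{\lambda}{2k}+\frac{v}{2k}+\frac12\\ \frac{v}{k}+1,\ \frac{\lambda}{2k}+\frac{v}{2k}+\frac{\alpha}{2},\ \frac{\lambda}{2k}+\frac{v}{2k}+\frac{\alpha+1}{2}\end{array};-\frac{cx^2}{4k}\right].$$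
   Context: The left-sided Riemann–Liouville fractional integral of order $\alpha\in\mathbb{C}$, $\Re(\alpha)>0$, is, for $x>0$, $$\left(I_{0+}^{\alpha}f\right)(x)=\frac{1}{\Gamma(\alpha)}\int_0^x (x-t)^{\alpha-1}f(t)\,dt.$$ The notation $\left(I_{0+}^{\alpha}g(t)\right)(x)$ means the operator applied to $t\mapsto g(t)$ on $(0,\infty)$ and evaluated at $x$. The $k$-Bessel function is $$W_{v,c}^{k}(z)=\sum_{n=0}^{\infty}\frac{(-c)^n}{\Gamma_k(nk+v+k)\,n!}\left(\frac{z}{2}\right)^{2n+\frac{v}{k}},$$ where $\Gamma_k(z)=\int_0^\infty t^{z-1}e^{-t^k/k}\,dt$ for $\Re(z)>0$, extended by $\Gamma_k(z)=k^{\frac{z}{k}-1}\Gamma\left(\frac{z}{k}\right)$. The generalized hypergeometric function is $${}_pF_q\left[\begin{array}{c}a_1,\dots,a_p\\ b_1,\dots,b_q\end{array};z\right]=\sum_{n=0}^\infty\frac{(a_1)_n\cdots(a_p)_n}{(b_1)_n\cdots(b_q)_n}\frac{z^n}{n!},\qquad b_j\ne0,-1,-2,\dots,$$ where $(a)_n$ is the Pochhammer symbol. Complex powers of positive reals are $y^s=e^{s\log y}$. *)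

(* Defs.v *)
(* Complex numbers are R[i] over R : realType, and R[i]^o is
   R[i] with the topology of its modulus.  The real part is written complex.Re,
   because the unqualified Re is the R[i]-valued one of numClosedFieldType. *)
From HB Require Import structures.
From mathcomp Require Export all_boot all_order all_algebra.
From mathcomp Require Export all_classical all_reals all_analysis.
From mathcomp Require Export complex.

Set Implicit Arguments.
Unset Strict Implicit.
Unset Printing Implicit Defensive.

Export Order.TTheory GRing.Theory Num.Theory.
Export numFieldNormedType.Exports.

Local Open Scope classical_set_scope.
Local Open Scope ring_scope.
Local Open Scope complex_scope.

Definition cexp (R : realType) (z : R[i]) : R[i] :=
  (expR (complex.Re z) * cos (complex.Im z)) +i*
  (expR (complex.Re z) * sin (complex.Im z)).

(* Meaningful for y > 0 only, since ln y = 0 for y <= 0. *)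
Definition cpow (R : realType) (y : R) (s : R[i]) : R[i] := cexp (s * (ln y)%:C).

Definition cintegrable (R : realType) (D : set R) (f : R -> R[i]) : Prop :=
  (@lebesgue_measure R).-integrable D (fun t => (complex.Re (f t))%:E) /\
  (@lebesgue_measure R).-integrable D (fun t => (complex.Im (f t))%:E).

Definition cintegral (R : realType) (D : set R) (f : R -> R[i]) : R[i] :=
  (\int[@lebesgue_measure R]_(t in D) complex.Re (f t)) +i*
  (\int[@lebesgue_measure R]_(t in D) complex.Im (f t)).

Definition cseries_cvg (R : realType) (u : nat -> R[i]) : Prop :=
  cvgn (series (u : nat -> R[i]^o)).

Definition cseries_sum (R : realType) (u : nat -> R[i]) : R[i] :=
  limn (series (u : nat -> R[i]^o)).

Definition pochhammer (R : realType) (a : R[i]) (n : nat) : R[i] :=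
  \prod_(i < n) (a + (i : nat)%:R).

Definition nonpos_int (R : realType) (z : R[i]) : Prop :=
  exists m : nat, z = - m%:R.

Definition Gamma_int (R : realType) (z : R[i]) : R[i] :=
  cintegral `]0, +oo[ (fun t : R => cpow t (z - 1) * (expR (- t))%:C).

(* Number of unit steps that bring z into the half-plane Re > 0. *)
Definition Gamma_shift (R : realType) (z : R[i]) : nat :=
  if 0 < complex.Re z then 0%N else (Num.truncn (- complex.Re z)).+1.

(* Euler's integral for Re z > 0, continued to the left half-plane by
   Gamma z = Gamma (z + n) / (z (z + 1) ... (z + n - 1)).  At the poles the
   value is 0 by the convention x / 0 = 0. *)
Definition Gamma (R : realType) (z : R[i]) : R[i] :=
  let n := Gamma_shift z in Gamma_int (z + n%:R) / pochhammer z n.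

Definition Gammak (R : realType) (k : R) (z : R[i]) : R[i] :=
  if 0 < complex.Re z
  then cintegral `]0, +oo[
         (fun t : R => cpow t (z - 1) * (expR (- ((t `^ k) / k)))%:C)
  else cpow k (z / k%:C - 1) * Gamma (z / k%:C).

Definition kBessel_term (R : realType) (k c : R) (v : R[i]) (t : R) (n : nat)
    : R[i] :=
  (- c%:C) ^+ n / (Gammak k (n%:R * k%:C + v + k%:C) * n`!%:R)
  * cpow (t / 2) ((2 * n)%:R + v / k%:C).

Definition kBessel (R : realType) (k c : R) (v : R[i]) (t : R) : R[i] :=
  cseries_sum (kBessel_term k c v t).

Definition pFq_term (R : realType) (a b : seq R[i]) (z : R[i]) (n : nat)
    : R[i] :=
  (\prod_(u <- a) pochhammer u n) / (\prod_(w <- b) pochhammer w n)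
  * (z ^+ n / n`!%:R).

Definition pFq (R : realType) (a b : seq R[i]) (z : R[i]) : R[i] :=
  cseries_sum (pFq_term a b z).

Definition RL_integrand (R : realType) (alpha : R[i]) (f : R -> R[i]) (x : R)
    : R -> R[i] :=
  fun t => cpow (x - t) (alpha - 1) * f t.

Definition RL_integral (R : realType) (alpha : R[i]) (f : R -> R[i]) (x : R)
    : R[i] :=
  (Gamma alpha)^-1 * cintegral `]0, x[ (RL_integrand alpha f x).

(* Main.v *)
Require Import Defs.
From mathcomp Require Import ring lra measurable_realfun.

(** Write [nu = v / k] and [mu = (lambda + v) / k]. The substitution
    [u = t ^ k / k] gives [Gamma_k z = k ^ (z / k - 1) Gamma (z / k)] in the
    right half-plane too, so the n-th term of the k-Bessel series is a constant
    times [t ^ nu] times [w ^ n t ^ (2 n) / ((nu + 1)_n n!)], where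
    [w = - c / (4 k)] ([kBessel_termE]). By the ratio test these series converge
    absolutely, uniformly for [t <= x]; hence dominated convergence allows the
    fractional integral to be taken term by term ([cintegral_power_series]), and
    each [t ^ (2 n)] contributes the Beta integral
    [x ^ (mu + 2 n + alpha - 1) B(mu + 2 n, alpha)].
    From [B(s, a) Gamma (s + a) = Gamma s Gamma a] and
    [(s)_(2 n) = 4 ^ n (s / 2)_n (s / 2 + 1 / 2)_n] one reads off the terms of
    the hypergeometric series, with the common factor
    [x ^ (mu + alpha - 1) Gamma mu Gamma alpha / Gamma (mu + alpha)]. This factor
    is not zero, so the convergence of the hypergeometric series follows from
    that of the integrated one.

    The facts about Gamma that are needed all come from one limit,
    [Beta_cvg_Gamma]: [n ^ a B(a, b + n + 1)] tends to [Gamma a]. Together with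
    the recurrence [(a + b) B(a, b + 1) = b B(a, b)], which is an integration by
    parts, the limit for [b = 0] is Euler's formula
    [Gamma s = lim n! n ^ s / (s)_(n + 1)] ([Gamma_int_Euler]). Euler's formula
    in turn gives the functional equation of Gamma, the relation between Beta
    and Gamma (by comparing terms at [a + b] and [b]), and the absence of zeros,
    because [|(s)_(n + 1)| <= K n! n ^ Re s] ([pochhammer_normc_le]).

    The integrands are singular at the ends of the domain. Integrability,
    primitives and substitutions are therefore treated on an increasing sequence
    of closed intervals and extended to their union ([exhausts]). *)

Set Implicit Arguments.
Unset Strict Implicit.
Unset Printing Implicit Defensive.

Local Open Scope classical_set_scope.
Local Open Scope ring_scope.
Local Open Scope complex_scope.

(** * Real and imaginary parts, modulus *)

Import Normc.
Arguments normc : simpl never.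

Lemma complexP (R : rcfType) (x y : R[i]) :
  complex.Re x = complex.Re y -> complex.Im x = complex.Im y -> x = y.
Proof. by case: x y => [a b] [c d] /= -> ->. Qed.

Lemma ReD (R : rcfType) (x y : R[i]) :
  complex.Re (x + y) = complex.Re x + complex.Re y.
Proof. by case: x y => [a b] [c d]. Qed.

Lemma ImD (R : rcfType) (x y : R[i]) :
  complex.Im (x + y) = complex.Im x + complex.Im y.
Proof. by case: x y => [a b] [c d]. Qed.

Lemma ReN (R : rcfType) (x : R[i]) : complex.Re (- x) = - complex.Re x.
Proof. by case: x. Qed.

Lemma ImN (R : rcfType) (x : R[i]) : complex.Im (- x) = - complex.Im x.
Proof. by case: x. Qed.

Lemma ReM (R : rcfType) (x y : R[i]) :
  complex.Re (x * y) = complex.Re x * complex.Re y - complex.Im x * complex.Im y.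
Proof. by case: x y => [a b] [c d]. Qed.

Lemma ImM (R : rcfType) (x y : R[i]) :
  complex.Im (x * y) = complex.Re x * complex.Im y + complex.Im x * complex.Re y.
Proof. by case: x y => [a b] [c d]. Qed.

Lemma natrC (R : rcfType) n : n%:R = (n%:R : R)%:C.
Proof. by rewrite rmorph_nat. Qed.

Lemma ReMr (R : rcfType) (z : R[i]) (r : R) :
  complex.Re (z * r%:C) = complex.Re z * r.
Proof. by rewrite ReM /= mulr0 subr0. Qed.

Lemma ImMr (R : rcfType) (z : R[i]) (r : R) :
  complex.Im (z * r%:C) = complex.Im z * r.
Proof. by rewrite ImM /= mulr0 add0r. Qed.

Lemma Re_nat (R : rcfType) n : complex.Re (n%:R : R[i]) = n%:R.
Proof. by rewrite natrC. Qed.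

Lemma Re1 (R : rcfType) : complex.Re (1 : R[i]) = 1.
Proof. by []. Qed.

Lemma ReB1 (R : rcfType) (x : R[i]) : complex.Re (x - 1) = complex.Re x - 1.
Proof. by rewrite ReD ReN. Qed.

Lemma Re_div_real (R : rcfType) (z : R[i]) (r : R) :
  complex.Re (z / r%:C) = complex.Re z / r.
Proof. by rewrite -fmorphV /= ReMr. Qed.

Lemma normc_real (R : rcfType) (r : R) : normc r%:C = `|r|.
Proof. by rewrite /normc /= expr0n addr0 sqrtr_sqr. Qed.

Lemma normc_ge0 (R : rcfType) (z : R[i]) : 0 <= normc z.
Proof. by case: z => a b; rewrite /normc sqrtr_ge0. Qed.

Lemma ler_Re_normc (R : rcfType) (z : R[i]) : `|complex.Re z| <= normc z.
Proof.
case: z => a b; rewrite /normc /= -sqrtr_sqr; apply: ler_wsqrtr.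
by rewrite lerDl sqr_ge0.
Qed.

Lemma ler_Im_normc (R : rcfType) (z : R[i]) : `|complex.Im z| <= normc z.
Proof.
case: z => a b; rewrite /normc /= -sqrtr_sqr; apply: ler_wsqrtr.
by rewrite lerDr sqr_ge0.
Qed.

Lemma normcD_le (R : rcfType) (x y : R[i]) : normc (x + y) <= normc x + normc y.
Proof. exact: le_normcD. Qed.

Lemma normc_le_ReIm (R : rcfType) (z : R[i]) :
  normc z <= `|complex.Re z| + `|complex.Im z|.
Proof.
case: z => a b; rewrite /normc /= -(@ler_sqr _ _ (_ + _)) ?nnegrE ?sqrtr_ge0 ?addr_ge0//.
rewrite sqr_sqrtr ?addr_ge0 ?sqr_ge0// sqrrD !real_normK ?num_real//.
by rewrite [leRHS]addrAC lerDl mulrn_wge0// mulr_ge0.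
Qed.

Lemma normcX (R : rcfType) (z : R[i]) n : normc (z ^+ n) = normc z ^+ n.
Proof.
elim: n => [|n IHn]; first by rewrite !expr0 normc1.
by rewrite !exprS normcM IHn.
Qed.

Lemma normc_gt0 (R : rcfType) (z : R[i]) : z != 0 -> 0 < normc z.
Proof.
by move=> z0; rewrite lt0r normc_ge0 andbT; apply: contra z0 => /eqP/eq0_normc/eqP.
Qed.

Lemma normc_sum (R : rcfType) (u : nat -> R[i]) n :
  normc (\sum_(i < n) u i) <= \sum_(i < n) normc (u i).
Proof.
elim: n => [|n IHn]; first by rewrite !big_ord0 normc0.
by rewrite !big_ord_recr /= (le_trans (normcD_le _ _))// lerD2r.
Qed.

(** * Powers of positive reals *)

Lemma cexpD (R : realType) (a b : R[i]) : cexp (a + b) = cexp a * cexp b.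
Proof.
apply: complexP; rewrite ?ReM ?ImM /= ReD ImD expRD ?cosD ?sinD; ring.
Qed.

Lemma cexp_real (R : realType) (r : R) : cexp r%:C = (expR r)%:C.
Proof. by apply: complexP; rewrite /= ?cos0 ?sin0 ?mulr1 ?mulr0. Qed.

Lemma normc_cexp (R : realType) (z : R[i]) : normc (cexp z) = expR (complex.Re z).
Proof.
rewrite /normc /= !exprMn -mulrDr cos2Dsin2 mulr1 sqrtr_sqr.
by rewrite ger0_norm// expR_ge0.
Qed.

Lemma cpowD (R : realType) (y : R) (a b : R[i]) :
  cpow y (a + b) = cpow y a * cpow y b.
Proof. by rewrite /cpow mulrDl cexpD. Qed.

Lemma cpow0 (R : realType) (y : R) : cpow y 0 = 1.
Proof. by rewrite /cpow mul0r (cexp_real 0) expR0. Qed.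

Lemma cpowM (R : realType) (x y : R) (s : R[i]) : 0 < x -> 0 < y ->
  cpow (x * y) s = cpow x s * cpow y s.
Proof.
by move=> x0 y0; rewrite /cpow lnM ?posrE// -cexpD rmorphD /= mulrDr.
Qed.

Lemma cpow_real (R : realType) (y r : R) : 0 < y -> cpow y r%:C = (y `^ r)%:C.
Proof.
by move=> y0; rewrite /cpow -rmorphM /= cexp_real /powR gt_eqF.
Qed.

Lemma cpow_nat (R : realType) (y : R) n : 0 < y -> cpow y n%:R = y%:C ^+ n.
Proof.
by move=> y0; rewrite natrC cpow_real// powR_mulrn ?ltW// rmorphXn.
Qed.

Lemma cpow1 (R : realType) (y : R) : 0 < y -> cpow y 1 = y%:C.
Proof. by move=> y0; rewrite (cpow_nat 1)// expr1. Qed.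

Lemma cpow1l (R : realType) (s : R[i]) : cpow 1 s = 1.
Proof. by rewrite /cpow ln1 mulr0 (cexp_real 0) expR0. Qed.

Lemma cpowDn (R : realType) (y : R) (s : R[i]) n : 0 < y ->
  cpow y (s + n%:R) = cpow y s * y%:C ^+ n.
Proof. by move=> y0; rewrite cpowD cpow_nat. Qed.

Lemma cpowB1 (R : realType) (y : R) (s : R[i]) : 0 < y ->
  cpow y s = cpow y (s - 1) * y%:C.
Proof. by move=> y0; rewrite -[X in _ * X](cpow1 y0) -cpowD subrK. Qed.

Lemma cpow_powR (R : realType) (y r : R) (s : R[i]) : 0 < y ->
  cpow (y `^ r) s = cpow y (r%:C * s).
Proof.
by move=> y0; rewrite /cpow ln_powR rmorphM /=; congr cexp; ring.
Qed.

Lemma normc_cpow (R : realType) (y : R) (s : R[i]) : 0 < y ->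
  normc (cpow y s) = y `^ complex.Re s.
Proof. by move=> y0; rewrite /cpow normc_cexp ReMr /powR gt_eqF. Qed.

Lemma cpow_neq0 (R : realType) (y : R) (s : R[i]) : cpow y s != 0.
Proof.
apply/eqP => e; have := normc_cexp (s * (ln y)%:C).
by rewrite [cexp _]e normc0 => /esym/eqP; rewrite expR_eq0.
Qed.

(** * Convergence of complex sequences, by components *)

(** Componentwise convergence: the real and imaginary parts are what the
    integration and series theorems for real functions speak about, and
    [ccvg_cvg] gives back convergence for the modulus. *)
Definition ccvg (R : realType) (u : nat -> R[i]) (l : R[i]) : Prop :=
  (complex.Re (u n) @[n --> \oo] --> complex.Re l) /\
  (complex.Im (u n) @[n --> \oo] --> complex.Im l).

Lemma ccvg_eq (R : realType) (u w : nat -> R[i]) (l : R[i]) :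
  u =1 w -> ccvg u l -> ccvg w l.
Proof. by move=> /funext ->. Qed.

Lemma ccvg_near (R : realType) (u w : nat -> R[i]) (l : R[i]) :
  (\forall n \near \oo, u n = w n) -> ccvg u l -> ccvg w l.
Proof.
move=> e [cr ci]; split; [move: cr|move: ci];
  by apply: cvg_trans; apply: near_eq_cvg; apply: filterS e => n /= ->.
Qed.

Lemma ccvg_cst (R : realType) (l : R[i]) : ccvg (fun=> l) l.
Proof. by split; exact: cvg_cst. Qed.

Lemma ccvgM (R : realType) (u w : nat -> R[i]) (l m : R[i]) :
  ccvg u l -> ccvg w m -> ccvg (fun n => u n * w n) (l * m).
Proof.
move=> [ur ui] [wr wi]; split.
- under eq_fun do rewrite ReM.
  by rewrite ReM; apply: cvgB; apply: cvgM.
- under eq_fun do rewrite ImM.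
  by rewrite ImM; apply: cvgD; apply: cvgM.
Qed.

Lemma ccvgD (R : realType) (u w : nat -> R[i]) (l m : R[i]) :
  ccvg u l -> ccvg w m -> ccvg (fun n => u n + w n) (l + m).
Proof.
move=> [ur ui] [wr wi]; split.
- by under eq_fun do rewrite ReD; rewrite ReD; exact: cvgD.
- by under eq_fun do rewrite ImD; rewrite ImD; exact: cvgD.
Qed.

Lemma ccvg_unique (R : realType) (u : nat -> R[i]) (l m : R[i]) :
  ccvg u l -> ccvg u m -> l = m.
Proof.
move=> [ur ui] [wr wi]; apply: complexP.
- by rewrite -(cvg_lim (@Rhausdorff R) ur); exact: cvg_lim.
- by rewrite -(cvg_lim (@Rhausdorff R) ui); exact: cvg_lim.
Qed.

Lemma ccvg_real (R : realType) (u : nat -> R) (l : R) :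
  u n @[n --> \oo] --> l -> ccvg (fun n => (u n)%:C) l%:C.
Proof. by move=> ul; split => //=; exact: cvg_cst. Qed.

Lemma ccvgV (R : realType) (u : nat -> R[i]) (l : R[i]) : l != 0 ->
  ccvg u l -> ccvg (fun n => (u n)^-1) l^-1.
Proof.
move=> l0 [ur ui].
have n0 : complex.Re l ^+ 2 + complex.Im l ^+ 2 != 0.
  apply: contra l0; rewrite paddr_eq0 ?sqr_ge0// !sqrf_eq0 => /andP[/eqP a /eqP b].
  by apply/eqP; apply: complexP.
have cn : (complex.Re (u n) ^+ 2 + complex.Im (u n) ^+ 2)^-1 @[n --> \oo]
    --> (complex.Re l ^+ 2 + complex.Im l ^+ 2)^-1.
  by apply: cvgV => //; apply: cvgD; rewrite expr2; under eq_fun do rewrite expr2;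
    apply: cvgM.
have reV (z : R[i]) : complex.Re z^-1 =
    complex.Re z * (complex.Re z ^+ 2 + complex.Im z ^+ 2)^-1 by case: z.
have imV (z : R[i]) : complex.Im z^-1 =
    - (complex.Im z * (complex.Re z ^+ 2 + complex.Im z ^+ 2)^-1) by case: z.
split.
- by under eq_fun do rewrite reV; rewrite reV; apply: cvgM.
- by under eq_fun do rewrite imV; rewrite imV; apply: cvgN; apply: cvgM.
Qed.

Lemma ccvg_cexp (R : realType) (u : nat -> R[i]) (l : R[i]) :
  ccvg u l -> ccvg (fun n => cexp (u n)) (cexp l).
Proof.
have ce := @continuous_expR R; have cc := @continuous_cos R.
have cs := @continuous_sin R.
by move=> [ur ui]; split => /=; apply: cvgM;
  apply: continuous_cvg => //; [exact: ce|exact: cc|exact: ce|exact: cs].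
Qed.

Lemma ccvg_cvg (R : realType) (u : nat -> R[i]) (l : R[i]) :
  ccvg u l -> (u : nat -> R[i]^o) @ \oo --> (l : R[i]^o).
Proof.
move=> [ur ui]; apply/cvgrPdist_lt => e e0.
have e' : e = (complex.Re e)%:C by apply/esym/RRe_real/gtr0_real.
move: e0; rewrite e' ltcR => e0.
have e2 : 0 < complex.Re e / 2 by rewrite divr_gt0.
move/cvgrPdist_lt: ur => /(_ _ e2) ur; move/cvgrPdist_lt: ui => /(_ _ e2) ui.
near=> n.
rewrite (_ : `|l - u n| = (normc (l - u n))%:C)//.
rewrite ltcR (le_lt_trans (normc_le_ReIm _))// [ltRHS]splitr ltrD//.
- by rewrite ReD ReN; near: n.
- by rewrite ImD ImN; near: n.
Unshelve. all: by end_near. Qed.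

Lemma cseries_cvgE (R : realType) (u : nat -> R[i]) (l : R[i]) :
  ccvg (fun n => \sum_(i < n) u i) l -> cseries_cvg u /\ cseries_sum u = l.
Proof.
move=> h; have h' : series (u : nat -> R[i]^o) @ \oo --> (l : R[i]^o).
  apply: ccvg_cvg; apply: ccvg_eq h => n.
  by rewrite /series /= big_mkord.
split; first by apply/cvg_ex; exists l.
exact: (cvg_lim (@norm_hausdorff _ (R[i]^o)) h').
Qed.

(** * Integrals over exhausted sets *)

(** Closed intervals on which the singular end points of [D] are cut off: there
    the fundamental theorem of calculus and the substitution rule apply, and
    both pass to the limit over the increasing union. *)
Definition exhausts (R : realType) (D : set R) (a b : nat -> R) : Prop :=
  [/\ forall n, a n < b n,
      nondecreasing_seq (fun n => `[a n, b n]%classic)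
    & \bigcup_n `[a n, b n]%classic = D].

Lemma exhausts_sub (R : realType) (D : set R) (a b : nat -> R) n :
  exhausts D a b -> `[a n, b n] `<=` D.
Proof. by case=> _ _ <- x abx; exists n. Qed.

Lemma exhausts_measurable (R : realType) (D : set R) (a b : nat -> R) :
  exhausts D a b -> measurable D.
Proof. by case=> _ _ <-; apply: bigcup_measurable => n _; exact: measurable_itv. Qed.

Lemma exhausts_itv0y (R : realType) :
  exhausts `]0, +oo[ (fun n => n.+2%:R^-1 : R) (fun n => n.+2%:R).
Proof.
split.
- move=> n; rewrite (@lt_trans _ _ 1)// ?ltr1n//.
  by rewrite invf_lt1// ltr1n.
- move=> m n mn; apply/subsetPset => x /=; rewrite !in_itv/= => /andP[h1 h2].
  rewrite (le_trans _ h1)/= ?(le_trans h2)//; first by rewrite ler_nat !ltnS.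
  by rewrite lef_pV2 ?posrE// ler_nat !ltnS.
- apply/seteqP; split => [x [n _] /=|x /=].
    rewrite !in_itv/= andbT => /andP[h _]; apply: lt_le_trans h.
    by rewrite invr_gt0.
  rewrite in_itv/= andbT => x0.
  exists (maxn (Num.truncn x) (Num.truncn x^-1)) => //=; rewrite in_itv/=.
  have xx : x <= (maxn (Num.truncn x) (Num.truncn x^-1)).+2%:R.
    rewrite (le_trans (ltW (truncnS_gt x)))// ler_nat ltnS.
    by rewrite (leq_trans (leq_maxl _ (Num.truncn x^-1))).
  rewrite xx andbT -[leRHS]invrK lef_pV2 ?posrE ?invr_gt0//.
  rewrite (le_trans (ltW (truncnS_gt x^-1)))// ler_nat ltnS.
  by rewrite (leq_trans (leq_maxr (Num.truncn x) _)).
Qed.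

Lemma exhausts_itv0 (R : realType) (x : R) : 0 < x ->
  exhausts `]0, x[ (fun n => x * n.+3%:R^-1) (fun n => x * (1 - n.+3%:R^-1)).
Proof.
move=> x0; have i3 n : (n.+3%:R^-1 : R) <= 3^-1.
  by rewrite lef_pV2 ?posrE// ler_nat.
have i0 n : 0 < (n.+3%:R^-1 : R) by rewrite invr_gt0.
split.
- by move=> n; rewrite ltr_pM2l//; move: (i3 n) (i0 n); move: n.+3%:R^-1 => r; lra.
- move=> m n mn; apply/subsetPset => y /=; rewrite !in_itv/= => /andP[h1 h2].
  have mn' : (n.+3%:R^-1 : R) <= m.+3%:R^-1.
    by rewrite lef_pV2 ?posrE// ler_nat !ltnS.
  rewrite (le_trans _ h1)/= ?(le_trans h2)// ler_pM2l//.
  by move: mn'; move: n.+3%:R^-1 m.+3%:R^-1 => r r'; lra.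
- apply/seteqP; split => [y [n _] /=|y /=].
    rewrite !in_itv/= => /andP[h h']; rewrite (lt_le_trans _ h) ?mulr_gt0//=.
    by rewrite (le_lt_trans h')// gtr_pMr// ltrBlDr ltrDl.
  rewrite in_itv/= => /andP[y0 yx].
  pose n := maxn (Num.truncn (x / y)) (Num.truncn (x / (x - y))).
  exists n => //=; rewrite in_itv/=.
  have xy : 0 < x - y by rewrite subr_gt0.
  have h z : 0 < z -> x / z < n.+3%:R -> x * n.+3%:R^-1 <= z.
    by move=> z0; rewrite ltr_pdivrMr// => /ltW h; rewrite ler_pdivrMr// mulrC.
  rewrite h//=; last first.
    rewrite (lt_le_trans (truncnS_gt _))// ler_nat ltnS -addn2.
    by rewrite (leq_trans _ (leq_addr _ _))// leq_maxl.
  rewrite mulrBr mulr1 lerBrDr addrC -lerBrDr h//.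
  rewrite (lt_le_trans (truncnS_gt _))// ler_nat ltnS -addn2.
  by rewrite (leq_trans _ (leq_addr _ _))// leq_maxr.
Qed.

(** Monotone convergence for the positive and negative parts. *)
Lemma exhausts_integral_cvg (R : realType) (D : set R) (a b : nat -> R)
    (f : R -> R) :
  exhausts D a b -> (@lebesgue_measure R).-integrable D (EFin \o f) ->
  \int[lebesgue_measure]_(t in `[a n, b n]) f t @[n --> \oo] -->
  \int[lebesgue_measure]_(t in D) f t.
Proof.
move=> ex fi; have mD := exhausts_measurable ex.
have sub n := exhausts_sub (n := n) ex.
have [_ nd UD] := ex.
have fin n : (@lebesgue_measure R).-integrable `[a n, b n] (EFin \o f).
  by apply: integrableS fi.
apply: fine_cvg; rewrite fineK; last exact: integrable_fin_num.
rewrite integralE; under eq_fun do rewrite integralE.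
apply: cvgeB.
- apply: fin_num_adde_defl; rewrite fin_numN.
  exact: integrable_neg_fin_num.
- rewrite -UD; apply: ge0_nondecreasing_set_cvg_integral => //.
  by move=> n; apply: measurable_funepos; exact: measurable_int (fin n).
- rewrite -UD; apply: ge0_nondecreasing_set_cvg_integral => //.
  by move=> n; apply: measurable_funeneg; exact: measurable_int (fin n).
Qed.

Lemma exhausts_integrable (R : realType) (D : set R) (a b : nat -> R)
    (f : R -> R) (M : R) :
  exhausts D a b -> measurable_fun D f ->
  (forall n, (\int[@lebesgue_measure R]_(t in `[a n, b n]) `|f t|%:E <= M%:E)%E) ->
  (@lebesgue_measure R).-integrable D (EFin \o f).
Proof.
move=> ex mf fM; have mD := exhausts_measurable ex.
have [_ nd UD] := ex.
apply/integrableP; split; first exact/measurable_EFinP.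
apply: (@le_lt_trans _ _ M%:E); last by rewrite ltry.
have h : (\int[@lebesgue_measure R]_(t in `[a n, b n]) `|f t|%:E @[n --> \oo]
    --> \int[lebesgue_measure]_(t in D) `|f t|%:E)%E.
  rewrite -UD; apply: ge0_nondecreasing_set_cvg_integral => //.
  move=> n; apply/measurable_EFinP; apply: measurableT_comp => //.
  by apply: measurable_funS mf => //; exact: exhausts_sub ex.
rewrite -(cvg_lim _ h)//; apply: lime_le; first by apply/cvg_ex; eexists; exact: h.
exact: nearW.
Qed.

Lemma FTC_itvcc (R : realType) (F f : R -> R) (a b : R) : a < b ->
  (forall t, a <= t <= b -> is_derive t 1 F (f t)) ->
  (forall t, a <= t <= b -> {for t, continuous f}) ->
  (\int[@lebesgue_measure R]_(t in `[a, b]) (f t)%:E = (F b - F a)%:E)%E.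
Proof.
move=> ab dF cf; rewrite EFinB; apply: continuous_FTC2 => //.
- apply: continuous_in_subspaceT => x; rewrite inE/= in_itv/= => xab; exact: cf.
- have cF x : a <= x <= b -> {for x, continuous F}.
    by move=> xab; apply/differentiable_continuous/derivable1_diffP; case: (dF _ xab).
  split.
  + by move=> x; rewrite in_itv/= => /andP[ax xb]; case: (dF x) => //; rewrite !ltW.
  + by apply: cvg_at_right_filter; apply: cF; rewrite lexx ltW.
  + by apply: cvg_at_left_filter; apply: cF; rewrite lexx ltW.
- move=> x; rewrite in_itv/= => /andP[ax xb]; rewrite derive1E.
  by case: (dF x) => //; rewrite !ltW.
Qed.

(** The integrals over the exhausting intervals are increments of [F], hence at
    most [M], and the monotone limit is the integral over [D]. *)
Lemma FTC_exhausts_integrable (R : realType) (D : set R) (a b : nat -> R)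
    (F f : R -> R) (M : R) :
  exhausts D a b -> measurable_fun D f ->
  (forall t, D t -> is_derive t 1 F (f t)) ->
  (forall t, D t -> {for t, continuous f}) ->
  (forall t, D t -> 0 <= f t) ->
  (forall s t, D s -> D t -> F t - F s <= M) ->
  (@lebesgue_measure R).-integrable D (EFin \o f).
Proof.
move=> ex mf dF cf f0 FM; have sub n t : a n <= t <= b n -> D t.
  by move=> abt; apply: (exhausts_sub (n := n) ex); rewrite /= in_itv.
apply: (exhausts_integrable (M := M) ex mf) => n.
have [ab _ _] := ex.
rewrite (_ : (\int[_]_(t in _) _ = \int[lebesgue_measure]_(t in `[a n, b n]) (f t)%:E)%E).
  rewrite (FTC_itvcc (ab n) (fun t h => dF _ (sub _ _ h)) (fun t h => cf _ (sub _ _ h))).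
  by rewrite lee_fin; apply: FM; apply: (sub n); rewrite lexx ltW.
apply: eq_integral => t; rewrite inE /= in_itv/= => abt.
by rewrite ger0_norm// f0//; exact: sub abt.
Qed.

(** The improper fundamental theorem of calculus: the increments of the
    primitive are the integrals over the exhausting intervals. *)
Lemma FTC_exhausts (R : realType) (D : set R) (a b : nat -> R) (F f : R -> R) :
  exhausts D a b -> (@lebesgue_measure R).-integrable D (EFin \o f) ->
  (forall t, D t -> is_derive t 1 F (f t)) ->
  (forall t, D t -> {for t, continuous f}) ->
  F (b n) - F (a n) @[n --> \oo] --> \int[lebesgue_measure]_(t in D) f t.
Proof.
move=> ex fi dF cf; have sub n t : a n <= t <= b n -> D t.
  by move=> abt; apply: (exhausts_sub (n := n) ex); rewrite /= in_itv.
have [ab _ _] := ex.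
have := exhausts_integral_cvg ex fi; apply: cvg_trans; apply: near_eq_cvg.
apply: nearW => n.
by rewrite /Rintegral (FTC_itvcc (ab n) (fun t h => dF _ (sub _ _ h))
  (fun t h => cf _ (sub _ _ h))).
Qed.

Lemma exhausts_image (R : realType) (D D' : set R) (a b : nat -> R)
    (phi psi : R -> R) :
  exhausts D a b ->
  {in D &, {homo phi : x y / x < y}} ->
  (forall t, D t -> D' (phi t)) -> (forall u, D' u -> D (psi u)) ->
  (forall t, D t -> psi (phi t) = t) -> (forall u, D' u -> phi (psi u) = u) ->
  (forall s t u, D' s -> D' t -> s <= u <= t -> D' u) ->
  exhausts D' (phi \o a) (phi \o b).
Proof.
move=> ex hphi phiD psiD phiK psiK conv.
have sub n t : a n <= t <= b n -> D t.
  by move=> abt; apply: (exhausts_sub (n := n) ex); rewrite /= in_itv.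
have [ab nd UD] := ex.
have aD n : D (a n) by apply: (sub n); rewrite lexx ltW.
have bD n : D (b n) by apply: (sub n); rewrite lexx ltW.
have wphi s t : D s -> D t -> s <= t -> phi s <= phi t.
  move=> Ds Dt; rewrite le_eqVlt => /predU1P[->//|st].
  by rewrite ltW// hphi ?inE.
have cphi s t : D s -> D t -> phi s <= phi t -> s <= t.
  move=> Ds Dt; apply: contra_le => st; by rewrite hphi ?inE.
split.
- by move=> n; apply: hphi; rewrite ?inE.
- move=> m n mn; apply/subsetPset => x /=; rewrite !in_itv/= => /andP[h1 h2].
  have /subsetPset h := nd _ _ mn.
  have /h/= : `[a m, b m]%classic (a m) by rewrite /= in_itv/= lexx ltW.
  have /h/= : `[a m, b m]%classic (b m) by rewrite /= in_itv/= lexx ltW.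
  rewrite !in_itv/= => /andP[_ bb] /andP[aa _].
  by rewrite (le_trans _ h1)/= ?(le_trans h2)// wphi.
- apply/seteqP; split => [x [n _] /=|u D'u /=].
    by rewrite in_itv/=; apply: conv; exact: phiD.
  have : D (psi u) by exact: psiD.
  rewrite -{1}UD => -[n _] /=; rewrite in_itv/= => /andP[h1 h2].
  exists n => //=; rewrite in_itv/= -(psiK u)// !wphi//; exact: psiD.
Qed.

(** On each closed interval this is the usual change of variables; the absolute
    values satisfy the same identities, which gives integrability on [D], and
    the exhausting intervals of [D] are mapped to exhausting intervals of [D']. *)
Lemma integration_by_substitution_exhausts (R : realType) (D D' : set R)
    (a b : nat -> R) (phi psi dphi f : R -> R) :
  exhausts D a b ->
  (forall t, D t -> D' (phi t)) -> (forall u, D' u -> D (psi u)) ->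
  (forall t, D t -> psi (phi t) = t) -> (forall u, D' u -> phi (psi u) = u) ->
  (forall s t u, D' s -> D' t -> s <= u <= t -> D' u) ->
  {in D &, {homo phi : x y / x < y}} ->
  open D ->
  (forall t, D t -> is_derive t 1 phi (dphi t)) ->
  (forall t, D t -> {for t, continuous dphi}) ->
  (forall t, D t -> 0 <= dphi t) ->
  (forall u, D' u -> {for u, continuous f}) ->
  measurable_fun D (fun t => f (phi t) * dphi t) ->
  (@lebesgue_measure R).-integrable D' (EFin \o f) ->
  (@lebesgue_measure R).-integrable D (fun t => (f (phi t) * dphi t)%:E) /\
  \int[lebesgue_measure]_(t in D) (f (phi t) * dphi t) =
  \int[lebesgue_measure]_(u in D') f u.
Proof.
move=> ex phiD psiD phiK psiK conv hphi oD dphiE cdphi dphi0 cf mfphi fi.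
have sub n t : a n <= t <= b n -> D t.
  by move=> abt; apply: (exhausts_sub (n := n) ex); rewrite /= in_itv.
have [ab nd UD] := ex.
have ex' := exhausts_image ex hphi phiD psiD phiK psiK conv.
have sub' n t : phi (a n) <= t <= phi (b n) -> D' t.
  by move=> abt; apply: (exhausts_sub (n := n) ex'); rewrite /= in_itv.
have deq t : D t -> (phi^`())%classic t = dphi t.
  by move=> Dt; rewrite derive1E; case: (dphiE _ Dt).
have cphi t : D t -> {for t, continuous phi}.
  by move=> Dt; apply/differentiable_continuous/derivable1_diffP; case: (dphiE _ Dt).
have cdphi' t : D t -> {for t, continuous (phi^`())%classic}.
  move=> Dt; rewrite /prop_for /continuous_at deq//.
  apply: cvg_trans (cdphi _ Dt); apply: near_eq_cvg.
  have : nbhs t D by apply: open_nbhs_nbhs.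
  by apply: filterS => s /deq ->.
have key (g : R -> R) n : (forall u, D' u -> {for u, continuous g}) ->
    (\int[@lebesgue_measure R]_(x in `[phi (a n), phi (b n)]) (g x)%:E =
     \int[@lebesgue_measure R]_(t in `[a n, b n]) (g (phi t) * dphi t)%:E)%E.
  move=> cg; rewrite (integration_by_substitution_increasing (ltW (ab n))).
  - apply: eq_integral => t; rewrite inE/= in_itv/= => /sub Dt.
    by rewrite fctE /= deq.
  - by move=> x y; rewrite !in_itv/= => /sub Dx /sub Dy; apply: hphi; rewrite inE.
  - move=> x; rewrite in_itv/= => /andP[h1 h2]; apply: cdphi'; apply: (sub n).
    by rewrite !ltW.
  - apply/cvg_ex; exists ((phi^`())%classic (a n)); apply: cvg_at_right_filter.
    by apply: cdphi'; apply: (sub n); rewrite lexx ltW.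
  - apply/cvg_ex; exists ((phi^`())%classic (b n)); apply: cvg_at_left_filter.
    by apply: cdphi'; apply: (sub n); rewrite lexx ltW.
  - split.
    + move=> x; rewrite in_itv/= => /andP[h1 h2].
      by case: (dphiE x) => //; apply: (sub n); rewrite !ltW.
    + by apply: cvg_at_right_filter; apply: cphi; apply: (sub n); rewrite lexx ltW.
    + by apply: cvg_at_left_filter; apply: cphi; apply: (sub n); rewrite lexx ltW.
  - apply: continuous_in_subspaceT => x; rewrite inE/= in_itv/= => /sub' D'x.
    exact: cg.
have mfn : measurable_fun D' f by move/measurable_int: fi => /measurable_EFinP.
have mD' := exhausts_measurable ex'.
have i : (@lebesgue_measure R).-integrable D (EFin \o (fun t => f (phi t) * dphi t)).
  apply: (exhausts_integrable
    (M := \int[lebesgue_measure]_(u in D') `|f u|) ex mfphi) => n.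
  rewrite (_ : (\int[_]_(t in _) _ = \int[lebesgue_measure]_(t in `[a n, b n])
      ((Num.norm \o f) (phi t) * dphi t)%:E)%E).
    rewrite -key; last first.
      move=> u D'u; apply: continuous_comp; first exact: cf.
      exact: norm_continuous.
    have fin : (@lebesgue_measure R).-integrable D' (EFin \o (Num.norm \o f)).
      exact: integrable_norm.
    rewrite /Rintegral fineK; last exact: integrable_fin_num.
    apply: ge0_subset_integral => //.
    + by move/measurable_int: fin.
    + by move=> t _; rewrite lee_fin /=.
    + by move=> t /=; rewrite in_itv/= => /sub'.
  apply: eq_integral => t; rewrite inE/= in_itv/= => /sub Dt.
  by rewrite normrM (ger0_norm (dphi0 _ Dt)).
split => //.
have h1 := exhausts_integral_cvg ex i.
have h2 := exhausts_integral_cvg ex' fi.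
have e : (fun n => \int[@lebesgue_measure R]_(t in `[a n, b n]) (f (phi t) * dphi t)) =
   (fun n => \int[@lebesgue_measure R]_(x in `[phi (a n), phi (b n)]) (f x)).
  by apply/funext => n; rewrite /Rintegral key.
by rewrite -(cvg_lim (@Rhausdorff R) h1) e; exact: cvg_lim h2.
Qed.

(** * Complex-valued Lebesgue integrals *)

Definition cmeasurable (R : realType) (D : set R) (f : R -> R[i]) : Prop :=
  measurable_fun D (fun t => complex.Re (f t)) /\
  measurable_fun D (fun t => complex.Im (f t)).

Lemma cmeasurableM (R : realType) (D : set R) (f g : R -> R[i]) :
  cmeasurable D f -> cmeasurable D g -> cmeasurable D (fun t => f t * g t).
Proof.
move=> [fr fi] [gr gi]; split.
- under eq_fun do rewrite ReM.
  by apply: measurable_funB; exact: measurable_funM.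
- under eq_fun do rewrite ImM.
  by apply: measurable_funD; exact: measurable_funM.
Qed.

Lemma cmeasurableD (R : realType) (D : set R) (f g : R -> R[i]) :
  cmeasurable D f -> cmeasurable D g -> cmeasurable D (fun t => f t + g t).
Proof.
move=> [fr fi] [gr gi]; split.
- by under eq_fun do rewrite ReD; exact: measurable_funD.
- by under eq_fun do rewrite ImD; exact: measurable_funD.
Qed.

Lemma cmeasurable_real (R : realType) (D : set R) (g : R -> R) :
  measurable_fun D g -> cmeasurable D (fun t => (g t)%:C).
Proof. by move=> mg; split => //=; exact: measurable_cst. Qed.

Lemma cmeasurable_cst (R : realType) (D : set R) (l : R[i]) :
  cmeasurable D (fun=> l).
Proof. by split; exact: measurable_cst. Qed.

Lemma cmeasurable_cpow (R : realType) (D : set R) (g : R -> R) (s : R[i]) :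
  measurable_fun D g -> cmeasurable D (fun t => cpow (g t) s).
Proof.
move=> mg.
have ml : measurable_fun D (fun t => ln (g t)).
  exact: (measurableT_comp (@measurable_ln R)).
have mr : measurable_fun D (fun t => complex.Re (s * (ln (g t))%:C)).
  by under eq_fun do rewrite ReMr; exact: measurable_funM.
have mi : measurable_fun D (fun t => complex.Im (s * (ln (g t))%:C)).
  by under eq_fun do rewrite ImMr; exact: measurable_funM.
split; apply: measurable_funM.
- exact: (measurableT_comp (@measurable_expR R)).
- apply: (measurableT_comp _ mi); apply: continuous_measurable_fun.
  exact: continuous_cos.
- exact: (measurableT_comp (@measurable_expR R)).
- apply: (measurableT_comp _ mi); apply: continuous_measurable_fun.
  exact: continuous_sin.
Qed.

Lemma cmeasurable_sum (R : realType) (D : set R) (f : nat -> R -> R[i]) n :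
  (forall i, cmeasurable D (f i)) -> cmeasurable D (fun t => \sum_(i < n) f i t).
Proof.
move=> mf; elim: n => [|n IHn].
  by under eq_fun do rewrite big_ord0; exact: cmeasurable_cst.
by under eq_fun do rewrite big_ord_recr /=; exact: cmeasurableD.
Qed.

Lemma cintegrable_dominated (R : realType) (D : set R) (f : R -> R[i])
    (g : R -> R) :
  measurable D -> cmeasurable D f -> (forall t, D t -> normc (f t) <= g t) ->
  (@lebesgue_measure R).-integrable D (EFin \o g) -> cintegrable D f.
Proof.
move=> mD [mr mi] fg gi; split.
- apply: le_integrable gi => //; first exact/measurable_EFinP.
  move=> t Dt /=; rewrite lee_fin (le_trans (ler_Re_normc _))//.
  by rewrite (le_trans (fg _ Dt))// ler_norm.
- apply: le_integrable gi => //; first exact/measurable_EFinP.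
  move=> t Dt /=; rewrite lee_fin (le_trans (ler_Im_normc _))//.
  by rewrite (le_trans (fg _ Dt))// ler_norm.
Qed.

Lemma eq_cintegral (R : realType) (D : set R) (f g : R -> R[i]) :
  (forall t, D t -> f t = g t) -> cintegral D f = cintegral D g.
Proof.
move=> fg; rewrite /cintegral; congr (_ +i* _);
  by apply: eq_Rintegral => t; rewrite inE => Dt; rewrite fg.
Qed.

Lemma eq_cintegrable (R : realType) (D : set R) (f g : R -> R[i]) :
  measurable D ->
  (forall t, D t -> f t = g t) -> cintegrable D f -> cintegrable D g.
Proof.
by move=> mD fg [fr fi]; split; [move: fr|move: fi]; apply: eq_integrable => // t;
  rewrite inE => Dt; rewrite fg.
Qed.

Lemma cintegrableD (R : realType) (D : set R) (f g : R -> R[i]) :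
  measurable D -> cintegrable D f -> cintegrable D g ->
  cintegrable D (fun t => f t + g t).
Proof.
move=> mD [fr fi] [gr gi]; split.
- by under eq_fun do rewrite ReD EFinD; exact: integrableD.
- by under eq_fun do rewrite ImD EFinD; exact: integrableD.
Qed.

Lemma cintegralD (R : realType) (D : set R) (f g : R -> R[i]) :
  measurable D -> cintegrable D f -> cintegrable D g ->
  cintegral D (fun t => f t + g t) = cintegral D f + cintegral D g.
Proof.
move=> mD [fr fi] [gr gi]; apply: complexP; rewrite ?ReD ?ImD /=.
- by under eq_Rintegral do rewrite ReD; exact: RintegralD.
- by under eq_Rintegral do rewrite ImD; exact: RintegralD.
Qed.

Lemma cintegrableZ (R : realType) (D : set R) (l : R[i]) (f : R -> R[i]) :
  measurable D -> cintegrable D f -> cintegrable D (fun t => l * f t).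
Proof.
move=> mD [fr fi]; split.
- under eq_fun do rewrite ReM EFinB !EFinM.
  by apply: integrableB => //; exact: integrableZl.
- under eq_fun do rewrite ImM EFinD !EFinM.
  by apply: integrableD => //; exact: integrableZl.
Qed.

Lemma cintegralZ (R : realType) (D : set R) (l : R[i]) (f : R -> R[i]) :
  measurable D -> cintegrable D f ->
  cintegral D (fun t => l * f t) = l * cintegral D f.
Proof.
move=> mD [fr fi].
have Zi (r : R) (g : R -> R) : (@lebesgue_measure R).-integrable D (EFin \o g) ->
    (@lebesgue_measure R).-integrable D (EFin \o (fun t => r * g t)).
  by move=> ig; have := @integrableZl _ _ R lebesgue_measure D mD r (EFin \o g) ig.
apply: complexP; rewrite ?ReM ?ImM /=.
- under eq_Rintegral do rewrite ReM.
  by rewrite RintegralB ?RintegralZl//; exact: Zi.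
- under eq_Rintegral do rewrite ImM.
  by rewrite RintegralD ?RintegralZl//; exact: Zi.
Qed.

Lemma cintegral_sum (R : realType) (D : set R) (f : nat -> R -> R[i]) n :
  measurable D -> (forall i, cintegrable D (f i)) ->
  cintegral D (fun t => \sum_(i < n) f i t) = \sum_(i < n) cintegral D (f i).
Proof.
move=> mD fi.
have zi : cintegrable D (fun=> 0 : R[i]) by split; exact: integrable0.
suff : cintegrable D (fun t => \sum_(i < n) f i t) /\
  cintegral D (fun t => \sum_(i < n) f i t) = \sum_(i < n) cintegral D (f i) by case.
elim: n => [|n [IHi IHn]].
  under [X in cintegrable _ X]eq_fun do rewrite big_ord0; split => //.
  rewrite big_ord0; under eq_cintegral do rewrite big_ord0.
  by rewrite -[RHS](mul0r (cintegral D (fun=> 0))) -cintegralZ//;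
    apply: eq_cintegral => t _; rewrite mul0r.
under [X in cintegrable _ X]eq_fun do rewrite big_ord_recr /=; split.
  exact: cintegrableD.
under eq_cintegral do rewrite big_ord_recr /=.
by rewrite cintegralD// IHn big_ord_recr.
Qed.

Lemma cdominated_convergence (R : realType) (D : set R)
    (u : nat -> R -> R[i]) (f : R -> R[i]) (g : R -> R) :
  measurable D -> (forall n, cmeasurable D (u n)) ->
  (forall t, D t -> ccvg (u ^~ t) (f t)) ->
  (forall n t, D t -> normc (u n t) <= g t) ->
  (@lebesgue_measure R).-integrable D (EFin \o g) ->
  cintegrable D f /\ ccvg (fun n => cintegral D (u n)) (cintegral D f).
Proof.
move=> mD mu uf ug gi.
have DC (v : nat -> R -> R) (h : R -> R) :
    (forall n, measurable_fun D (v n)) ->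
    (forall t, D t -> v n t @[n --> \oo] --> h t) ->
    (forall n t, D t -> `|v n t| <= g t) ->
    (@lebesgue_measure R).-integrable D (EFin \o h) /\
    \int[lebesgue_measure]_(t in D) v n t @[n --> \oo] -->
      \int[lebesgue_measure]_(t in D) h t.
  move=> mv vh vg; have mh := measurable_fun_cvg mv vh.
  have [] := @dominated_convergence _ _ R lebesgue_measure D mD
    (fun n t => (v n t)%:E) (EFin \o h) (EFin \o g).
  - by move=> n; apply/measurable_EFinP; exact: mv.
  - by apply/measurable_EFinP; exact: mh.
  - by apply: aeW => t Dt; apply: cvg_EFin; [exact: nearW|exact: vh].
  - exact: gi.
  - by apply: aeW => t n Dt /=; rewrite lee_fin; exact: vg.
  move=> hi _ hc; split => //; apply: fine_cvg.
  by rewrite /Rintegral fineK//; exact: integrable_fin_num.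
have [ri rc] := DC (fun n t => complex.Re (u n t)) (fun t => complex.Re (f t))
  (fun n => (mu n).1) (fun t Dt => (uf t Dt).1)
  (fun n t Dt => le_trans (ler_Re_normc _) (ug n t Dt)).
have [ii ic] := DC (fun n t => complex.Im (u n t)) (fun t => complex.Im (f t))
  (fun n => (mu n).2) (fun t Dt => (uf t Dt).2)
  (fun n t Dt => le_trans (ler_Im_normc _) (ug n t Dt)).
by split.
Qed.

(** * Differentiation of complex-valued functions of a real variable *)

Definition is_cderive (R : realType) (t : R) (f : R -> R[i]) (l : R[i]) : Prop :=
  is_derive t 1 (fun u => complex.Re (f u)) (complex.Re l) /\
  is_derive t 1 (fun u => complex.Im (f u)) (complex.Im l).

Definition ccontinuous_at (R : realType) (t : R) (f : R -> R[i]) : Prop :=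
  {for t, continuous (fun u => complex.Re (f u))} /\
  {for t, continuous (fun u => complex.Im (f u))}.

Lemma is_cderive_continuous (R : realType) (t : R) (f : R -> R[i]) (l : R[i]) :
  is_cderive t f l -> ccontinuous_at t f.
Proof.
by move=> [[dr _] [di _]]; split;
  exact/differentiable_continuous/derivable1_diffP.
Qed.

Lemma ccontinuous_cst (R : realType) (t : R) (l : R[i]) :
  ccontinuous_at t (fun=> l).
Proof. by split; exact: cst_continuous. Qed.

Lemma ccontinuousD (R : realType) (t : R) (f g : R -> R[i]) :
  ccontinuous_at t f -> ccontinuous_at t g ->
  ccontinuous_at t (fun u => f u + g u).
Proof.
move=> [fr fi] [gr gi]; split.
- rewrite /prop_for /continuous_at ReD; under eq_fun do rewrite ReD.
  exact: cvgD.
- rewrite /prop_for /continuous_at ImD; under eq_fun do rewrite ImD.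
  exact: cvgD.
Qed.

Lemma ccontinuousM (R : realType) (t : R) (f g : R -> R[i]) :
  ccontinuous_at t f -> ccontinuous_at t g ->
  ccontinuous_at t (fun u => f u * g u).
Proof.
move=> [fr fi] [gr gi]; split.
- rewrite /prop_for /continuous_at ReM; under eq_fun do rewrite ReM.
  by apply: cvgB; exact: cvgM.
- rewrite /prop_for /continuous_at ImM; under eq_fun do rewrite ImM.
  by apply: cvgD; exact: cvgM.
Qed.

Lemma is_cderive_cst (R : realType) (t : R) (l : R[i]) :
  is_cderive t (fun=> l) 0.
Proof. by split; exact: is_derive_cst. Qed.

Lemma is_cderiveM (R : realType) (t : R) (f g : R -> R[i]) (l m : R[i]) :
  is_cderive t f l -> is_cderive t g m ->
  is_cderive t (fun u => f u * g u) (l * g t + f t * m).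
Proof.
move=> [fr fi] [gr gi]; split.
- under eq_fun do rewrite ReM.
  apply: (is_derive_eq (is_deriveB (is_deriveM fr gr) (is_deriveM fi gi))).
  by rewrite ReD !ReM /GRing.scale /=; ring.
- under eq_fun do rewrite ImM.
  apply: (is_derive_eq (is_deriveD (is_deriveM fr gi) (is_deriveM fi gr))).
  by rewrite ImD !ImM /GRing.scale /=; ring.
Qed.

Lemma is_cderive_cexp (R : realType) (t : R) (w : R -> R[i]) (l : R[i]) :
  is_cderive t w l -> is_cderive t (fun u => cexp (w u)) (cexp (w t) * l).
Proof.
move=> [wr wi].
have er := is_derive1_comp (is_derive_expR (complex.Re (w t))) wr.
have ec := is_derive1_comp (is_derive_cos (complex.Im (w t))) wi.
have es := is_derive1_comp (is_derive_sin (complex.Im (w t))) wi.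
split.
- apply: (is_derive_eq (is_deriveM er ec)).
  by rewrite ReM /GRing.scale /=; ring.
- apply: (is_derive_eq (is_deriveM er es)).
  by rewrite ImM /GRing.scale /=; ring.
Qed.

Lemma is_cderive_cpow (R : realType) (t : R) (g : R -> R) (dg : R) (s : R[i]) :
  0 < g t -> is_derive t 1 g dg ->
  is_cderive t (fun u => cpow (g u) s) (s * cpow (g t) (s - 1) * dg%:C).
Proof.
move=> g0 gd.
have lg := is_derive1_comp (is_derive1_ln g0) gd.
have hw : is_cderive t (fun u => s * (ln (g u))%:C) (s * (dg / g t)%:C).
  have e : dg / g t = (g t)^-1 * dg by rewrite mulrC.
  split.
  - under eq_fun do rewrite ReMr; rewrite ReMr e.
    exact: (is_derive_eq (is_deriveZ (complex.Re s) lg)).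
  - under eq_fun do rewrite ImMr; rewrite ImMr e.
    exact: (is_derive_eq (is_deriveZ (complex.Im s) lg)).
have := is_cderive_cexp hw; rewrite -/(cpow _ _) (cpowB1 s g0).
rewrite rmorphM fmorphV /=; congr is_cderive.
have gn : (g t)%:C != 0 by rewrite -(rmorph0 (real_complex R)) (inj_eq (@complexI _)) gt_eqF.
by field.
Qed.

Lemma cFTC_exhausts (R : realType) (D : set R) (a b : nat -> R)
    (F f : R -> R[i]) :
  exhausts D a b -> cintegrable D f ->
  (forall t, D t -> is_cderive t F (f t)) ->
  (forall t, D t -> ccontinuous_at t f) ->
  ccvg (fun n => F (b n) - F (a n)) (cintegral D f).
Proof.
move=> ex [fr fi] dF cf; split.
- under eq_fun do rewrite ReD ReN.
  apply: (FTC_exhausts (F := fun t => complex.Re (F t)) ex fr).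
  + by move=> t /dF[].
  + by move=> t /cf[].
- under eq_fun do rewrite ImD ImN.
  apply: (FTC_exhausts (F := fun t => complex.Im (F t)) ex fi).
  + by move=> t /dF[].
  + by move=> t /cf[].
Qed.

(** The substitution rule applied to the real and imaginary parts; [phi] and
    [psi] are mutually inverse. *)
Lemma csubstitution_exhausts (R : realType) (D D' : set R)
    (a b : nat -> R) (phi psi dphi : R -> R) (f : R -> R[i]) :
  exhausts D a b ->
  (forall t, D t -> D' (phi t)) -> (forall u, D' u -> D (psi u)) ->
  (forall t, D t -> psi (phi t) = t) -> (forall u, D' u -> phi (psi u) = u) ->
  (forall s t u, D' s -> D' t -> s <= u <= t -> D' u) ->
  {in D &, {homo phi : x y / x < y}} ->
  open D ->
  (forall t, D t -> is_derive t 1 phi (dphi t)) ->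
  (forall t, D t -> {for t, continuous dphi}) ->
  (forall t, D t -> 0 <= dphi t) ->
  (forall u, D' u -> ccontinuous_at u f) ->
  cmeasurable D (fun t => f (phi t) * (dphi t)%:C) ->
  cintegrable D' f ->
  cintegrable D (fun t => f (phi t) * (dphi t)%:C) /\
  cintegral D (fun t => f (phi t) * (dphi t)%:C) = cintegral D' f.
Proof.
move=> ex h1 h2 h3 h4 h5 h6 h7 h8 h9 h10 cf [mr mi] [fr fi].
have [] := @integration_by_substitution_exhausts R D D' a b phi psi dphi
  (fun u => complex.Re (f u)) ex h1 h2 h3 h4 h5 h6 h7 h8 h9 h10.
- by move=> u /cf[].
- by move: mr; under eq_fun do rewrite ReMr.
- exact: fr.
move=> ir er.
have [] := @integration_by_substitution_exhausts R D D' a b phi psi dphi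
  (fun u => complex.Im (f u)) ex h1 h2 h3 h4 h5 h6 h7 h8 h9 h10.
- by move=> u /cf[].
- by move: mi; under eq_fun do rewrite ImMr.
- exact: fi.
move=> ii ei; split.
  by split; under eq_fun do rewrite ?ReMr ?ImMr.
apply: complexP => /=.
- by rewrite -er; apply: eq_Rintegral => t _; rewrite ReMr.
- by rewrite -ei; apply: eq_Rintegral => t _; rewrite ImMr.
Qed.

(** * Integrability of the Beta and Gamma integrands *)

Lemma is_derive_powR (R : realType) (t a : R) (g : R -> R) (dg : R) :
  0 < g t -> is_derive t 1 g dg ->
  is_derive t 1 (fun u => g u `^ a) (a * g t `^ (a - 1) * dg).
Proof.
move=> g0 gd.
have g0' : g t \in `]0, +oo[ by rewrite in_itv/= g0.
have h : is_derive (g t) 1 (fun y : R => y `^ a) (a * g t `^ (a - 1)).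
  apply: DeriveDef; first exact: derivable_powR.
  by rewrite -derive1E powR_derive1.
by apply: (is_derive_eq (is_derive1_comp h gd)).
Qed.

Lemma is_derive_powR_id (R : realType) (t a : R) : 0 < t ->
  is_derive t 1 (fun u : R => u `^ a) (a * t `^ (a - 1)).
Proof.
move=> t0; rewrite -[_ * t `^ _]mulr1.
by apply: (@is_derive_powR R t a id 1) => //; exact: is_derive_id.
Qed.

Lemma powR_le1 (R : realType) (t a : R) : 0 < a -> 0 <= t <= 1 -> t `^ a <= 1.
Proof.
move=> a0 /andP[t0 t1]; have := @ge0_ler_powR R a (ltW a0) t 1.
by rewrite powR1 !nnegrE => -> //.
Qed.

Lemma powR_integrable01 (R : realType) (a : R) : 0 < a ->
  (@lebesgue_measure R).-integrable `]0, 1[ (EFin \o (fun t : R => t `^ (a - 1))).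
Proof.
move=> a0.
apply: (@FTC_exhausts_integrable R _ _ _ (fun t => a^-1 * t `^ a) _ a^-1
  (exhausts_itv0 ltr01)).
- by apply: measurable_funTS; exact: measurable_powR.
- move=> t /=; rewrite in_itv/= => /andP[t0 _].
  apply: (is_derive_eq (is_deriveZ a^-1 (is_derive_powR_id a t0))).
  by rewrite /GRing.scale /= mulKf// gt_eqF.
- move=> t /=; rewrite in_itv/= => /andP[t0 _].
  by apply/differentiable_continuous/derivable1_diffP;
    case: (is_derive_powR_id (a - 1) t0).
- by move=> t _; exact: powR_ge0.
- move=> s t; rewrite /= !in_itv/= => /andP[s0 _] /andP[t0 t1].
  rewrite -mulrBr ler_piMr// ?invr_ge0; first exact: ltW.
  rewrite lerBlDr (@le_trans _ _ 1)//; last by rewrite lerDl powR_ge0.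
  by rewrite powR_le1// !ltW.
Qed.

Lemma powR_onem_integrable01 (R : realType) (a : R) : 0 < a ->
  (@lebesgue_measure R).-integrable `]0, 1[ (EFin \o (fun t : R => (1 - t) `^ (a - 1))).
Proof.
move=> a0.
have d (t b : R) : t < 1 ->
    is_derive t 1 (fun u : R => (1 - u) `^ b) (b * (1 - t) `^ (b - 1) * -1).
  move=> t1; apply: (@is_derive_powR R t b (fun u => 1 - u) (-1)).
    by rewrite subr_gt0.
  by apply: is_derive_eq; rewrite add0r mul1r.
apply: (@FTC_exhausts_integrable R _ _ _ (fun t => - a^-1 * (1 - t) `^ a) _ a^-1
  (exhausts_itv0 ltr01)).
- apply: measurable_funTS; apply: (measurableT_comp (measurable_powR _)).
  exact: measurable_funB.
- move=> t /=; rewrite in_itv/= => /andP[_ t1].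
  apply: (is_derive_eq (is_deriveZ (- a^-1) (d t a t1))).
  by rewrite /GRing.scale /= mulrN1 mulrNN mulKf// gt_eqF.
- move=> t /=; rewrite in_itv/= => /andP[_ t1].
  by apply/differentiable_continuous/derivable1_diffP; case: (d t (a - 1) t1).
- by move=> t _; exact: powR_ge0.
- move=> s t; rewrite /= !in_itv/= => /andP[s0 s1] /andP[t0 t1].
  rewrite -mulrBr mulNr -mulrN opprB.
  rewrite ler_piMr// ?invr_ge0; first exact: ltW.
  rewrite lerBlDr (@le_trans _ _ 1)//; last by rewrite lerDl powR_ge0.
  by rewrite powR_le1// subr_ge0 gerBl !ltW.
Qed.

(** Since [1 = t + (1 - t)], the integrand is
    [t ^ a (1 - t) ^ (b - 1) + t ^ (a - 1) (1 - t) ^ b], which is at most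
    [(1 - t) ^ (b - 1) + t ^ (a - 1)]. *)
Lemma beta_integrable (R : realType) (a b : R) : 0 < a -> 0 < b ->
  (@lebesgue_measure R).-integrable `]0, 1[
    (EFin \o (fun t : R => t `^ (a - 1) * (1 - t) `^ (b - 1))).
Proof.
move=> a0 b0.
have := @integrableD _ _ R (@lebesgue_measure R) `]0%R, 1%R[%classic
  (measurable_itv _) _ _ (powR_integrable01 a0) (powR_onem_integrable01 b0).
apply: le_integrable => //.
  apply/measurable_EFinP; apply: measurable_funTS; apply: measurable_funM.
    exact: measurable_powR.
  apply: (measurableT_comp (measurable_powR _)); exact: measurable_funB.
move=> t /=; rewrite in_itv/= => /andP[t0 t1].
have t1' : 0 < 1 - t by rewrite subr_gt0.
rewrite lee_fin !ger0_norm ?addr_ge0 ?mulr_ge0 ?powR_ge0//.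
have hp : t * t `^ (a - 1) <= 1 by rewrite (mulr_powRB1 (ltW t0) a0) powR_le1// ltW//= ltW.
have hq : (1 - t) * (1 - t) `^ (b - 1) <= 1.
  by rewrite (mulr_powRB1 (ltW t1') b0) powR_le1// (ltW t1')/= gerBl ltW.
move: hp hq (powR_ge0 t (a - 1)) (powR_ge0 (1 - t) (b - 1)).
move: (powR t (a - 1)) (powR (1 - t) (b - 1)) => P Q hp hq P0 Q0.
have -> : P * Q = t * P * Q + (1 - t) * Q * P by ring.
by rewrite [leRHS]addrC lerD// ler_piMl.
Qed.

(** The bound by [t ^ (a - 1) / (1 + t) ^ (a + 1)] is chosen because that
    function has the bounded primitive [(t / (1 + t)) ^ a / a]. *)
Lemma gamma_integrable (R : realType) (a : R) : 0 < a ->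
  (@lebesgue_measure R).-integrable `]0, +oo[
    (EFin \o (fun t : R => t `^ (a - 1) * expR (- t))).
Proof.
move=> a0; pose p := a + 1; have p0 : 0 < p by rewrite addr_gt0.
have d1 (t b : R) : 0 < t ->
    is_derive t 1 (fun u : R => (1 + u) `^ b) (b * (1 + t) `^ (b - 1) * 1).
  move=> t0; apply: (@is_derive_powR R t b (fun u => 1 + u) 1).
    by rewrite addr_gt0.
  by apply: is_derive_eq; ring.
have ig : (@lebesgue_measure R).-integrable `]0, +oo[
    (EFin \o (fun t : R => t `^ (a - 1) * (1 + t) `^ (- p))).
  apply: (@FTC_exhausts_integrable R _ _ _
    (fun t => a^-1 * (t `^ a * (1 + t) `^ (- a))) _ a^-1 (exhausts_itv0y R)).
  - apply: measurable_funTS; apply: measurable_funM; first exact: measurable_powR.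
    apply: (measurableT_comp (measurable_powR _)); exact: measurable_funD.
  - move=> t /=; rewrite in_itv/= andbT => t0.
    apply: (is_derive_eq (is_deriveZ a^-1 (is_deriveM (is_derive_powR_id a t0) (d1 t (- a) t0)))).
    have t1 : 0 < 1 + t by rewrite addr_gt0.
    rewrite /GRing.scale /= !mulr1 (_ : - a - 1 = - p); last by rewrite /p opprD.
    rewrite (_ : (1 + t) `^ (- a) = (1 + t) * (1 + t) `^ (- p)); last first.
      rewrite -{2}(powRr1 (ltW t1)) -powRD; last by rewrite (gt_eqF t1) implybT.
      by rewrite /p opprD addrCA addrN addr0.
    rewrite -(mulr_powRB1 (ltW t0) a0).
    have an : a != 0 by rewrite gt_eqF.
    by field.
  - move=> t /=; rewrite in_itv/= andbT => t0.
    by apply/differentiable_continuous/derivable1_diffP;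
      case: (is_deriveM (is_derive_powR_id (a - 1) t0) (d1 t (- p) t0)).
  - by move=> t _; rewrite mulr_ge0 ?powR_ge0.
  - move=> s t; rewrite /= !in_itv/= !andbT => s0 t0.
    rewrite -mulrBr ler_piMr// ?invr_ge0; first exact: ltW.
    rewrite lerBlDr (@le_trans _ _ 1)//; last by rewrite lerDl mulr_ge0 ?powR_ge0.
    rewrite powRN ler_pdivrMr ?mul1r; last by rewrite powR_gt0// addr_gt0.
    have := @ge0_ler_powR R a (ltW a0) t (1 + t).
    by rewrite !nnegrE => -> //; rewrite ?addr_ge0 ?ltW// ltrDr.
have := @integrableZl _ _ R (@lebesgue_measure R) `]0%R, +oo[%classic
  (measurable_itv _) (p `^ p * expR (1 - p)) _ ig.
apply: le_integrable => //.
  apply/measurable_EFinP; apply: measurable_funTS; apply: measurable_funM.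
    exact: measurable_powR.
  by apply: (measurableT_comp (@measurable_expR R)).
move=> t /=; rewrite in_itv/= andbT => t0.
rewrite lee_fin !ger0_norm ?mulr_ge0 ?powR_ge0 ?expR_ge0//.
have t1 : 0 < 1 + t by rewrite addr_gt0.
(* The constant is the maximum of [(1 + t) ^ p exp (- t)], attained at
   [1 + t = p]; it comes from [ln y <= y - 1] at [y = (1 + t) / p]. *)
rewrite mulrCA ler_wpM2l ?powR_ge0// powRN ler_pdivlMr ?powR_gt0//.
rewrite {1}/powR gt_eqF// -expRD {1}/powR gt_eqF// -expRD ler_expR.
have : ln ((1 + t) / p) <= (1 + t) / p - 1.
  have := @le_ln1Dx R ((1 + t) / p - 1).
  rewrite [1 + (_ - 1)]addrC subrK; apply.
  by rewrite ltrBDr addNr divr_gt0.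
rewrite ln_div ?posrE// -(ler_pM2l p0) mulrBr mulrBr mulr1 mulrCA mulfV ?gt_eqF//.
by lra.
Qed.

Lemma cintegrable_beta (R : realType) (a b : R[i]) :
  0 < complex.Re a -> 0 < complex.Re b ->
  cintegrable `]0, 1[ (fun t : R => cpow t (a - 1) * cpow (1 - t) (b - 1)).
Proof.
move=> a0 b0; apply: cintegrable_dominated (beta_integrable a0 b0) => //.
- by apply: cmeasurableM; apply: cmeasurable_cpow => //; exact: measurable_funB.
- move=> t; rewrite [D in D -> _]/= in_itv/= => /andP[t0 t1].
  by rewrite normcM !normc_cpow ?subr_gt0// !ReB1.
Qed.

Lemma cintegrable_gamma (R : realType) (a : R[i]) : 0 < complex.Re a ->
  cintegrable `]0, +oo[ (fun t : R => cpow t (a - 1) * (expR (- t))%:C).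
Proof.
move=> a0; apply: cintegrable_dominated (gamma_integrable a0) => //.
- apply: cmeasurableM; first exact: cmeasurable_cpow.
  apply: cmeasurable_real; apply: measurable_funTS.
  exact: (measurableT_comp (@measurable_expR R)).
- move=> t; rewrite [D in D -> _]/= in_itv/= andbT => t0.
  by rewrite normcM normc_real normc_cpow// ReB1 ger0_norm// expR_ge0.
Qed.

(** * Pochhammer symbols *)

Lemma pochhammer0 (R : realType) (a : R[i]) : pochhammer a 0 = 1.
Proof. by rewrite /pochhammer big_ord0. Qed.

Lemma pochhammerS (R : realType) (a : R[i]) n :
  pochhammer a n.+1 = pochhammer a n * (a + n%:R).
Proof. by rewrite /pochhammer big_ord_recr. Qed.

Lemma pochhammerSl (R : realType) (a : R[i]) n :
  pochhammer a n.+1 = a * pochhammer (a + 1) n.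
Proof.
rewrite /pochhammer big_ord_recl /= addr0; congr (_ * _).
by apply: eq_bigr => i _; rewrite /bump /= add1n -natr1; ring.
Qed.

Lemma pochhammer1 (R : realType) n : pochhammer (1 : R[i]) n = n`!%:R.
Proof.
elim: n => [|n IHn]; first by rewrite pochhammer0.
by rewrite pochhammerS IHn factS natrM nat1r mulrC.
Qed.

Lemma pochhammer_neq0 (R : realType) (a : R[i]) n :
  ~ nonpos_int a -> pochhammer a n != 0.
Proof.
move=> na; elim: n => [|n IHn]; first by rewrite pochhammer0 oner_neq0.
rewrite pochhammerS mulf_neq0//; apply/eqP => /eqP.
by rewrite addr_eq0 => /eqP e; apply: na; exists n.
Qed.

Lemma Re_gt0_nonpos_int (R : realType) (a : R[i]) :
  0 < complex.Re a -> ~ nonpos_int a.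
Proof. by move=> a0 [m e]; move: a0; rewrite e ReN Re_nat oppr_gt0 ltrn0. Qed.

(** * The complex Beta integral *)

Definition Beta (R : realType) (a b : R[i]) : R[i] :=
  cintegral `]0, 1[ (fun t : R => cpow t (a - 1) * cpow (1 - t) (b - 1)).

Lemma ccvg0_norm (R : realType) (u : nat -> R[i]) (v : nat -> R) :
  (forall n, normc (u n) <= v n) -> v n @[n --> \oo] --> 0 -> ccvg u 0.
Proof.
move=> uv v0; split.
- apply/norm_cvg0P; apply: (squeeze_cvgr _ (cvg_cst 0) v0).
  apply: nearW => n; rewrite normr_ge0/=.
  by rewrite (le_trans (ler_Re_normc _)).
- apply/norm_cvg0P; apply: (squeeze_cvgr _ (cvg_cst 0) v0).
  apply: nearW => n; rewrite normr_ge0/=.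
  by rewrite (le_trans (ler_Im_normc _)).
Qed.

Lemma ccvg_norm0 (R : realType) (u : nat -> R[i]) :
  ccvg u 0 -> normc (u n) @[n --> \oo] --> 0.
Proof.
move=> [ur ui].
have s : `|complex.Re (u n)| + `|complex.Im (u n)| @[n --> \oo] --> (0 : R).
  by rewrite -[0]addr0; apply: cvgD; apply/norm_cvg0P.
apply: (squeeze_cvgr _ (cvg_cst 0) s); apply: nearW => n.
by rewrite normc_ge0 normc_le_ReIm.
Qed.

Lemma cvg_invn3 (R : realType) : (n.+3%:R^-1 : R) @[n --> \oo] --> 0.
Proof.
have h := @cvg_harmonic R; rewrite -(cvg_shiftn 2) in h.
apply: cvg_trans h; apply: near_eq_cvg; apply: nearW => n.
by rewrite /harmonic /= addn2.
Qed.

Lemma powR_invn3_cvg0 (R : realType) (r : R) : 0 < r ->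
  (n.+3%:R^-1 : R) `^ r @[n --> \oo] --> 0.
Proof.
move=> r0; have /cvg_at_rightP := powR_cvg0 r0; apply; split.
  by move=> n; rewrite invr_gt0.
exact: cvg_invn3.
Qed.

Lemma itv01_ccontinuous_beta (R : realType) (a b : R[i]) (t : R) : 0 < t < 1 ->
  ccontinuous_at t (fun t : R => cpow t a * cpow (1 - t) b).
Proof.
move=> /andP[t0 t1]; have t1' : 0 < 1 - t by rewrite subr_gt0.
apply: is_cderive_continuous; apply: is_cderiveM.
  apply: (@is_cderive_cpow R t id 1 a t0).
by apply: (@is_cderive_cpow R t (fun u => 1 - u) _ b t1').
Qed.

(** The primitive of the integrand is [t ^ a / a]. *)
Lemma Beta_one (R : realType) (a : R[i]) : 0 < complex.Re a -> Beta a 1 = a^-1.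
Proof.
move=> a0; have an0 : a != 0.
  by apply/eqP => e; move: a0; rewrite e ltxx.
have b1 : 0 < complex.Re (1 : R[i]) by rewrite Re1.
have ib := cintegrable_beta a0 b1.
have h : ccvg (fun n => a^-1 * cpow (1 * (1 - n.+3%:R^-1)) a -
                        a^-1 * cpow (1 * n.+3%:R^-1) a) (Beta a 1).
  apply: (cFTC_exhausts (F := fun t : R => a^-1 * cpow t a) (exhausts_itv0 ltr01) ib).
  - move=> t; rewrite [X in X -> _]/= in_itv/= => /andP[t0 t1].
    have := is_cderiveM (is_cderive_cst t a^-1) (@is_cderive_cpow R t id 1 a t0 (is_derive_id t 1)).
    congr is_cderive; rewrite /= mul0r add0r mulr1 mulKf// subrr cpow0 mulr1//.
  - move=> t; rewrite [X in X -> _]/= in_itv/=; exact: itv01_ccontinuous_beta.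
have u0 : ccvg (fun n => cpow (n.+3%:R^-1 : R) a) 0.
  apply: ccvg0_norm (powR_invn3_cvg0 a0) => n.
  by rewrite normc_cpow ?invr_gt0.
have u1 : ccvg (fun n => cpow (1 - n.+3%:R^-1 : R) a) 1.
  rewrite -(cpow1l a); apply: ccvg_cexp.
  apply: ccvgM; first exact: ccvg_cst.
  apply: ccvg_real; apply: continuous_cvg; first exact: continuous_ln.
  by rewrite -[X in _ --> X]subr0; apply: cvgB; [exact: cvg_cst|exact: cvg_invn3].
apply: (ccvg_unique h).
have /= := ccvgM (ccvg_cst a^-1) (ccvgD u1 (ccvgM (ccvg_cst (-1)) u0)).
rewrite mulr0 addr0 mulr1; apply: ccvg_eq => n.
by rewrite !mul1r; ring.
Qed.

(** The derivative of [t ^ a (1 - t) ^ b], which vanishes at both ends, is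
    [(a + b) t ^ (a - 1) (1 - t) ^ b - b t ^ (a - 1) (1 - t) ^ (b - 1)]. *)
Lemma Beta_succ (R : realType) (a b : R[i]) :
  0 < complex.Re a -> 0 < complex.Re b ->
  (a + b) * Beta a (b + 1) = b * Beta a b.
Proof.
move=> a0 b0.
have b10 : 0 < complex.Re (b + 1) by rewrite ReD Re1 addr_gt0.
have ib := cintegrable_beta a0 b0.
have ib1 := cintegrable_beta a0 b10.
have mI : measurable `]0 : R, 1[ by exact: measurable_itv.
have Zib := cintegrableZ (- b) mI ib.
have Zib1 := cintegrableZ (a + b) mI ib1.
have h : ccvg (fun n => cpow (1 * (1 - n.+3%:R^-1) : R) a * cpow (1 - 1 * (1 - n.+3%:R^-1)) b -
                        cpow (1 * n.+3%:R^-1 : R) a * cpow (1 - 1 * n.+3%:R^-1) b)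
   ((a + b) * Beta a (b + 1) + (- b) * Beta a b).
  rewrite /Beta -!cintegralZ// -cintegralD//.
  apply: (cFTC_exhausts (F := fun t : R => cpow t a * cpow (1 - t) b)
     (exhausts_itv0 ltr01)).
  - exact: cintegrableD.
  - move=> t; rewrite [X in X -> _]/= in_itv/= => /andP[t0 t1].
    have t1' : 0 < 1 - t by rewrite subr_gt0.
    have d1 : is_derive t 1 (fun u : R => 1 - u) (-1).
      by apply: is_derive_eq; rewrite add0r mul1r.
    have := is_cderiveM (@is_cderive_cpow R t id 1 a t0 (is_derive_id t 1))
       (@is_cderive_cpow R t (fun u => 1 - u) (-1) b t1' d1).
    congr is_cderive; rewrite /= addrK.
    rewrite (cpowB1 a t0) (cpowB1 b t1') !rmorphB rmorph1 rmorphN1 /=.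
    by ring.
  - move=> t; rewrite [X in X -> _]/= in_itv/= => t01.
    by apply: ccontinuousD; apply: ccontinuousM; (try exact: ccontinuous_cst);
      exact: itv01_ccontinuous_beta.
have i0 n : 0 < (n.+3%:R^-1 : R) by rewrite invr_gt0.
have i1 n : 0 < (1 - n.+3%:R^-1 : R) by rewrite subr_gt0 invf_lt1// ltr1n.
have u0 : ccvg (fun n => cpow (n.+3%:R^-1 : R) a * cpow (1 - n.+3%:R^-1 : R) b) 0.
  apply: ccvg0_norm (powR_invn3_cvg0 a0) => n.
  rewrite normcM !normc_cpow// ler_piMr ?powR_ge0//.
  by rewrite powR_le1// (ltW (i1 n))/= gerBl ltW.
have u1 : ccvg (fun n => cpow (1 - n.+3%:R^-1 : R) a * cpow (n.+3%:R^-1 : R) b) 0.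
  apply: ccvg0_norm (powR_invn3_cvg0 b0) => n.
  rewrite normcM !normc_cpow// ler_piMl ?powR_ge0//.
  by rewrite powR_le1// (ltW (i1 n))/= gerBl ltW.
have e : (a + b) * Beta a (b + 1) + (- b) * Beta a b = 0.
  apply: (ccvg_unique h).
  have /= := ccvgD u1 (ccvgM (ccvg_cst (-1)) u0).
  rewrite mulr0 addr0; apply: ccvg_eq => n.
  by rewrite !mul1r subKr mulN1r.
by apply/eqP; rewrite -subr_eq0 -mulNr e.
Qed.

Lemma Beta_shift (R : realType) (a b : R[i]) n :
  0 < complex.Re a -> 0 < complex.Re b ->
  pochhammer (a + b) n * Beta a (b + n%:R) = pochhammer b n * Beta a b.
Proof.
move=> a0 b0; elim: n => [|n IHn]; first by rewrite !pochhammer0 addr0.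
have bn0 : 0 < complex.Re (b + n%:R) by rewrite ReD Re_nat ltr_wpDr.
rewrite !pochhammerS -natr1 (addrA b) -[LHS]mulrA -(addrA a) Beta_succ//.
by rewrite mulrCA IHn; ring.
Qed.

Lemma cintegral_scale (R : realType) (y : R) (f : R -> R[i]) : 0 < y ->
  cmeasurable setT f ->
  (forall t, 0 < t < 1 -> ccontinuous_at t f) -> cintegrable `]0, 1[ f ->
  cintegrable `]0, y[ (fun u => f (u / y)) /\
  cintegral `]0, y[ (fun u => f (u / y)) = y%:C * cintegral `]0, 1[ f.
Proof.
move=> y0 [mr mi] cf fi.
have yn0 : y != 0 by rewrite gt_eqF.
have mI : measurable `]0 : R, y[ by exact: measurable_itv.
have mdiv : measurable_fun (setT : set R) (fun u : R => u / y).
  exact: measurable_funM.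
have [] := @csubstitution_exhausts R `]0, y[ `]0, 1[ _ _ (fun u => u / y)
  (fun t => t * y) (fun=> y^-1) f (exhausts_itv0 y0).
- move=> t; rewrite /= !in_itv/= => /andP[t0 t1].
  by rewrite divr_gt0//= ltr_pdivrMr// mul1r.
- move=> t; rewrite /= !in_itv/= => /andP[t0 t1].
  by rewrite mulr_gt0//= gtr_pMl.
- by move=> t _; rewrite divfK.
- by move=> t _; rewrite mulfK.
- move=> s t u; rewrite /= !in_itv/= => /andP[s0 _] /andP[_ t1] /andP[su ut].
  by rewrite (lt_le_trans s0 su) (le_lt_trans ut t1).
- by move=> s t _ _ st; rewrite ltr_pM2r// invr_gt0.
- exact: interval_open.
- by move=> t _; apply: is_derive_eq; rewrite /GRing.scale /=; ring.
- by move=> t _; exact: cst_continuous.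
- by move=> t _; rewrite invr_ge0 ltW.
- by move=> t; rewrite [X in X -> _]/= in_itv/=; exact: cf.
- apply: cmeasurableM; last exact: cmeasurable_cst.
  split; apply: measurable_funTS.
    exact: (measurableT_comp mr mdiv).
  exact: (measurableT_comp mi mdiv).
- exact: fi.
move=> i e; have e' (u : R) : f (u / y) = y%:C * (f (u / y) * (y^-1)%:C).
  by rewrite mulrCA -rmorphM mulfV// mulr1.
have -> : (fun u => f (u / y)) = (fun u => y%:C * (f (u / y) * (y^-1)%:C)).
  by apply/funext => u.
by rewrite cintegralZ// e; split => //; exact: cintegrableZ.
Qed.

(** Lets integrals over varying domains be compared by dominated convergence on
    a fixed one. *)
Lemma cintegral_indic (R : realType) (D P : set R) (g : R -> R[i]) :
  measurable D -> measurable P -> P `<=` D ->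
  cintegral D (fun t => g t * (\1_P t : R)%:C) = cintegral P g.
Proof.
move=> mD mP PD; rewrite /cintegral -{3 4}(setIidr PD).
rewrite !Rintegral_mkcondr !patch_indic; congr (_ +i* _).
- by apply: eq_Rintegral => t _; rewrite ReMr.
- by apply: eq_Rintegral => t _; rewrite ImMr.
Qed.

(** * Gamma as a limit of Beta integrals *)

Lemma ln_le_subr1 (R : realType) (y : R) : 0 < y -> ln y <= y - 1.
Proof.
move=> y0; have := @le_ln1Dx R (y - 1); rewrite [1 + _]addrC subrK; apply.
by rewrite ltrBDr addNr.
Qed.

Lemma ge_ln_1subV (R : realType) (y : R) : 0 < y -> 1 - y^-1 <= ln y.
Proof.
move=> y0; have := @ln_le_subr1 R y^-1; rewrite invr_gt0 => /(_ y0).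
by rewrite lnV ?posrE// => h; lra.
Qed.

Lemma onem_div_gt0 (R : realType) (t : R) n : t < n.+1%:R ->
  0 < 1 - t / n.+1%:R.
Proof. by move=> tn; rewrite subr_gt0 ltr_pdivrMr// mul1r. Qed.

Lemma cvg_harm (R : realType) : (n.+1%:R^-1 : R) @[n --> \oo] --> 0.
Proof. exact: cvg_harmonic. Qed.

Lemma cvg_onem_div (R : realType) (t : R) :
  1 - t / n.+1%:R @[n --> \oo] --> (1 : R).
Proof.
rewrite -[X in _ --> X]subr0; apply: cvgB; first exact: cvg_cst.
rewrite -[X in _ --> X](mulr0 t); apply: cvgM; first exact: cvg_cst.
exact: cvg_harm.
Qed.

(** Squeezed by [1 - 1 / y <= ln y <= y - 1] at [y = 1 - t / n]. *)
Lemma cvg_ln_onem (R : realType) (t : R) : 0 < t ->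
  ln (1 - t / n.+1%:R) * n.+1%:R @[n --> \oo] --> - t.
Proof.
move=> t0.
apply: (@squeeze_cvgr _ _ _ _ (fun n => - t * (1 - t / n.+1%:R)^-1) (fun=> - t)).
- exists (Num.truncn t) => // n /= tn.
  have tn' : t < n.+1%:R.
    by rewrite (lt_le_trans (truncnS_gt t))// ler_nat ltnS.
  have p := onem_div_gt0 tn'.
  have n0 : 0 < n.+1%:R :> R by [].
  apply/andP; split.
  + rewrite -ler_pdivrMr//; apply: le_trans (ge_ln_1subV p).
    rewrite le_eqVlt; apply/orP; left; apply/eqP.
    have pn : n.+1%:R - t != 0 by rewrite gt_eqF// subr_gt0.
    have nn : n.+1%:R != 0 :> R by rewrite gt_eqF.
    by move: pn nn; move: (n.+1%:R : R) => m pn nn; field; rewrite nn pn.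
  + rewrite -ler_pdivlMr//; apply: le_trans (ln_le_subr1 p) _.
    by rewrite addrC addKr mulNr.
- rewrite -[X in _ --> X]mulr1; apply: cvgM; first exact: cvg_cst.
  rewrite -[X in _ --> X]invr1; apply: cvgV; first exact: oner_neq0.
  exact: cvg_onem_div.
- exact: cvg_cst.
Qed.

Lemma ccvg_onem_cpow (R : realType) (b : R[i]) (t : R) : 0 < t ->
  ccvg (fun n => cpow (1 - t / n.+1%:R) (b + n.+1%:R)) (expR (- t))%:C.
Proof.
move=> t0; rewrite -cexp_real.
apply: ccvg_cexp.
have h1 := cvg_ln_onem t0.
have h2 : ln (1 - t / n.+1%:R) @[n --> \oo] --> (0 : R).
  rewrite -(ln1 R); apply: continuous_cvg; first exact: continuous_ln.
  exact: cvg_onem_div.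
have := ccvgD (ccvgM (ccvg_cst b) (ccvg_real h2)) (ccvg_real h1).
rewrite rmorph0 mulr0 add0r; apply: ccvg_eq => n.
by rewrite mulrDl; congr (_ + _); rewrite [RHS]mulrC rmorphM natrC.
Qed.

Lemma normc_onem_cpow_le (R : realType) (b : R[i]) (t : R) n :
  0 <= complex.Re b -> 0 < t < n.+1%:R ->
  normc (cpow (1 - t / n.+1%:R) (b + n.+1%:R)) <= expR (- t).
Proof.
move=> b0 /andP[t0 tn]; have p := onem_div_gt0 tn.
rewrite normc_cpow// /powR gt_eqF// ler_expR ReD Re_nat.
have l : ln (1 - t / n.+1%:R) <= - (t / n.+1%:R).
  by apply: le_trans (ln_le_subr1 p) _; rewrite addrC addKr.
have l0 : ln (1 - t / n.+1%:R) <= 0.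
  by rewrite (le_trans l)// oppr_le0 divr_ge0// ltW.
rewrite mulrDl; have := mulr_ge0_le0 b0 l0.
have : n.+1%:R * ln (1 - t / n.+1%:R) <= - t.
  rewrite (@le_trans _ _ (n.+1%:R * - (t / n.+1%:R)))//.
    by rewrite ler_pM2l.
  by rewrite mulrN mulrCA mulfV ?mulr1.
by lra.
Qed.

Lemma cpow_div (R : realType) (t y : R) (s : R[i]) : 0 < t -> 0 < y ->
  cpow (t / y) s = cpow t s / cpow y s.
Proof.
move=> t0 y0; rewrite -[in RHS](divfK (lt0r_neq0 y0) t).
by rewrite (cpowM s (divr_gt0 t0 y0) y0) mulfK// cpow_neq0.
Qed.

Lemma cmeasurable_beta (R : realType) (a b : R[i]) :
  cmeasurable (setT : set R) (fun t => cpow t a * cpow (1 - t) b).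
Proof.
by apply: cmeasurableM; apply: cmeasurable_cpow => //; exact: measurable_funB.
Qed.

Lemma Beta_scale (R : realType) (a b : R[i]) n :
  0 < complex.Re a -> 0 < complex.Re b ->
  cpow n.+1%:R a * Beta a b =
  cintegral `]0, n.+1%:R[
    (fun t : R => cpow t (a - 1) * cpow (1 - t / n.+1%:R) (b - 1)).
Proof.
move=> a0 b0; have n0 : 0 < n.+1%:R :> R by [].
have [i e] := cintegral_scale n0 (cmeasurable_beta (a - 1) (b - 1))
  (@itv01_ccontinuous_beta R (a - 1) (b - 1)) (cintegrable_beta a0 b0).
rewrite (cpowB1 a n0) -mulrA -e -cintegralZ//.
apply: eq_cintegral => t; rewrite /= in_itv/= => /andP[t0 _].
rewrite mulrA; congr (_ * _).
by rewrite cpow_div// mulrC divfK// cpow_neq0.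
Qed.

(** Substituting [t = u / n] turns [n ^ a B(a, b + n + 1)] into the integral of
    [u ^ (a - 1) (1 - u / n) ^ (b + n)] over [0 < u < n], which is dominated by
    the integrand of Gamma because [(1 - u / n) ^ n <= exp (- u)]. *)
Lemma Beta_cvg_Gamma (R : realType) (a b : R[i]) :
  0 < complex.Re a -> 0 <= complex.Re b ->
  ccvg (fun n => cpow n.+1%:R a * Beta a (b + n.+1%:R + 1)) (Gamma_int a).
Proof.
move=> a0 b0.
pose P n := `]0 : R, n.+1%:R[%classic.
pose u n t : R[i] := cpow t (a - 1) * cpow (1 - t / n.+1%:R) (b + n.+1%:R)
  * (\1_(P n) t : R)%:C.
have mdiv n : measurable_fun (setT : set R) (fun t : R => 1 - t / n.+1%:R).
  by apply: measurable_funB => //; exact: measurable_funM.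
have [|||| _ h] := @cdominated_convergence R `]0, +oo[ u
  (fun t : R => cpow t (a - 1) * (expR (- t))%:C)
  (fun t : R => t `^ (complex.Re a - 1) * expR (- t)) (measurable_itv _).
- move=> n; apply: cmeasurableM; last first.
    by apply: cmeasurable_real; apply: measurable_indic; exact: measurable_itv.
  apply: cmeasurableM; first exact: cmeasurable_cpow.
  by apply: cmeasurable_cpow; exact: measurable_funTS.
- move=> t; rewrite [X in X -> _]/= in_itv/= andbT => t0.
  have := ccvgM (ccvg_cst (cpow t (a - 1))) (ccvg_onem_cpow b t0).
  apply: ccvg_near; exists (Num.truncn t) => // n /= tn.
  have tP : P n t.
    by rewrite /P /= in_itv/= t0 (lt_le_trans (truncnS_gt t))// ler_nat ltnS.
  by rewrite /u indicE mem_set// mulr1.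
- move=> n t; rewrite [X in X -> _]/= in_itv/= andbT => t0.
  rewrite /u indicE; case: (boolP (t \in P n)) => tP; last first.
    by rewrite mulr0 normc0 mulr_ge0 ?powR_ge0 ?expR_ge0.
  rewrite mulr1 normcM normc_cpow// ReB1 ler_wpM2l ?powR_ge0//.
  by apply: normc_onem_cpow_le => //; move: tP; rewrite inE /P /= in_itv.
- exact: gamma_integrable.
apply: ccvg_eq h => n.
have mP : measurable (P n) by exact: measurable_itv.
have sP : P n `<=` `]0, +oo[%classic.
  by move=> t; rewrite /P /= !in_itv/= andbT => /andP[].
rewrite /u cintegral_indic//.
by rewrite Beta_scale// ?addrK// !ReD Re1 Re_nat -addrA ltr_wpDl.
Qed.

(** Euler's formula: the case [b = 0] of the previous limit, where
    [B(s, n + 1) = n! / (s (s + 1) ... (s + n))]. *)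
Lemma Gamma_int_Euler (R : realType) (s : R[i]) : 0 < complex.Re s ->
  ccvg (fun n => cpow n.+1%:R s * (n.+1)`!%:R / pochhammer s n.+2) (Gamma_int s).
Proof.
move=> s0; have h := @Beta_cvg_Gamma R s 0 s0 (lexx _).
apply: ccvg_eq h => n; rewrite add0r -mulrA; congr (_ * _).
have := @Beta_shift R s 1 n.+1 s0; rewrite Re1 => /(_ ltr01).
rewrite Beta_one// pochhammer1 [1 + _%:R]addrC => e.
have sn : s != 0 by apply/eqP => s00; move: s0; rewrite s00 ltxx.
have pn : pochhammer (s + 1) n.+1 != 0.
  by apply/pochhammer_neq0/Re_gt0_nonpos_int; rewrite ReD Re1 addr_gt0.
apply: (mulfI pn); rewrite e [pochhammer s _]pochhammerSl.
by field; rewrite sn pn.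
Qed.

Lemma ccvg_harmonic_nat (R : realType) (l : R[i]) :
  ccvg (fun n => n.+1%:R / (n.+1%:R + l)) 1.
Proof.
have h : ccvg (fun n => 1 + l * (n.+1%:R^-1 : R)%:C) 1.
  have := ccvgD (ccvg_cst 1) (ccvgM (ccvg_cst l) (ccvg_real (@cvg_harm R))).
  by rewrite rmorph0 mulr0 addr0.
have := ccvgV (oner_neq0 _) h; rewrite invr1; apply: ccvg_eq => n.
have nn : n.+1%:R != 0 :> R[i] by rewrite pnatr_eq0.
rewrite -[n.+1%:R / _]invrK invfM invrK; congr _^-1.
by rewrite mulrDr mulVf// [_ * l]mulrC fmorphV rmorph_nat.
Qed.

(** The terms of Euler's formula at [s + 1] and at [s] have the ratio
    [s n / (n + s + 1)], which tends to [s]. *)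
Lemma Gamma_int_succ (R : realType) (s : R[i]) : 0 < complex.Re s ->
  Gamma_int (s + 1) = s * Gamma_int s.
Proof.
move=> s0; have s10 : 0 < complex.Re (s + 1) by rewrite ReD Re1 addr_gt0.
have sn : s != 0 by apply/eqP => s00; move: s0; rewrite s00 ltxx.
apply: (ccvg_unique (Gamma_int_Euler s10)).
have := ccvgM (ccvgM (ccvg_cst s) (Gamma_int_Euler s0)) (ccvg_harmonic_nat (s + 1)).
rewrite mulr1; apply: ccvg_eq => n.
have p1 : pochhammer s n.+2 != 0 by apply/pochhammer_neq0/Re_gt0_nonpos_int.
have p2 : pochhammer (s + 1) n.+2 != 0 by apply/pochhammer_neq0/Re_gt0_nonpos_int.
have e : pochhammer s n.+2 * (n.+1%:R + (s + 1)) = s * pochhammer (s + 1) n.+2.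
  by rewrite -pochhammerSl [RHS]pochhammerS -natr1; congr (_ * _); ring.
have p3 : n.+1%:R + (s + 1) != 0.
  apply/eqP => e0; move/eqP: e; rewrite e0 mulr0 eq_sym mulf_eq0 (negbTE sn).
  by rewrite (negbTE p2).
have -> : (pochhammer (s + 1) n.+2)^-1 =
    s / (pochhammer s n.+2 * (n.+1%:R + (s + 1))).
  by rewrite e invfM mulVKf.
by rewrite cpowD cpow1// rmorph_nat invfM; ring.
Qed.

(** By [Beta_shift], [B(a, b)] times the n-th term of Euler's formula at [a + b]
    is [n ^ a B(a, b + n + 1)] times the n-th term at [b]; these two factors
    tend to Gamma at [a] and at [b]. *)
Lemma Beta_Gamma (R : realType) (a b : R[i]) :
  0 < complex.Re a -> 0 < complex.Re b ->
  Beta a b * Gamma_int (a + b) = Gamma_int a * Gamma_int b.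
Proof.
move=> a0 b0; have ab0 : 0 < complex.Re (a + b) by rewrite ReD addr_gt0.
apply: (ccvg_unique (ccvgM (ccvg_cst (Beta a b)) (Gamma_int_Euler ab0))).
have := ccvgM (Beta_cvg_Gamma a0 (ltW b0)) (Gamma_int_Euler b0).
apply: ccvg_eq => n.
have p1 : pochhammer (a + b) n.+2 != 0 by apply/pochhammer_neq0/Re_gt0_nonpos_int.
have p2 : pochhammer b n.+2 != 0 by apply/pochhammer_neq0/Re_gt0_nonpos_int.
have e := Beta_shift n.+2 a0 b0.
have -> : Beta a (b + n.+1%:R + 1) = pochhammer b n.+2 * Beta a b / pochhammer (a + b) n.+2.
  by apply: (mulfI p1); rewrite -addrA natr1 e; field.
by rewrite cpowD; field; rewrite p1 p2.
Qed.

(** * Gamma has no zeros *)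

Lemma normc_1D_le (R : realType) (w : R[i]) :
  normc (1 + w) <= expR (complex.Re w + normc w ^+ 2 / 2).
Proof.
have n2 (z : R[i]) : normc z ^+ 2 = complex.Re z ^+ 2 + complex.Im z ^+ 2.
  by case: z => x y; rewrite /normc sqr_sqrtr ?addr_ge0 ?sqr_ge0.
rewrite -(@ler_sqr _ (normc _)) ?nnegrE ?normc_ge0 ?expR_ge0//.
rewrite -expRM_natl (n2 (1 + w)) ReD ImD /=.
apply: le_trans (expR_ge1Dx _); rewrite n2 add0r.
by rewrite mulrDr [_ / 2]mulrC mulrA mulfV// mul1r; lra.
Qed.

(** Proved by induction with the further factor [exp (- c / n)] on the right,
    where [c = |s| ^ 2 / 2]. The factor [|1 + s / m|], for [m = n + 1], is at most
    [exp (Re s / m + c / m ^ 2)]; here [exp (Re s / m)] is absorbed because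
    [n ^ Re s exp (Re s / m) <= m ^ Re s], and [exp (c / m ^ 2)] because
    [1 / m ^ 2 <= 1 / n - 1 / m]. *)
Lemma pochhammer_normc_le (R : realType) (s : R[i]) : 0 < complex.Re s ->
  exists2 K : R, 0 < K & forall n,
  normc (pochhammer s n.+2) <= K * ((n.+1)`!%:R * n.+1%:R `^ complex.Re s).
Proof.
move=> s0; set sg := complex.Re s in s0 *.
have sn : s != 0 by apply/eqP => e; move: s0; rewrite /sg e ltxx.
pose c := normc s ^+ 2 / 2.
have c0 : 0 <= c by rewrite divr_ge0// sqr_ge0.
pose K := normc (pochhammer s 2) * expR c.
have K0 : 0 < K.
  by rewrite mulr_gt0 ?expR_gt0// normc_gt0//; apply/pochhammer_neq0/Re_gt0_nonpos_int.
exists K => // n.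
suff h : normc (pochhammer s n.+2) <=
    K * ((n.+1)`!%:R * n.+1%:R `^ sg) * expR (- (c / n.+1%:R)).
  apply: le_trans h _; rewrite ler_piMr//.
    by apply: mulr_ge0; [exact: ltW|apply: mulr_ge0 => //; exact: powR_ge0].
  by rewrite expR_le1 oppr_le0 divr_ge0.
elim: n => [|n IHn].
  have -> : 1`!%:R = 1 :> R by [].
  by rewrite powR1 !mulr1 divr1 -mulrA -expRD subrr expR0 mulr1.
rewrite pochhammerS normcM.
have m0 : 0 < n.+1%:R :> R by [].
have m10 : 0 < n.+2%:R :> R by [].
set m := n.+1%:R in IHn m0 *; set m1 := n.+2%:R in m10 *.
have mm1 : m1 = m + 1 by rewrite natr1.
have step : normc (s + n.+2%:R) <= m1 * expR (sg / m1 + c / m1 ^+ 2).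
  have mC : m1%:C = n.+2%:R by rewrite /m1 rmorph_nat.
  have -> : s + n.+2%:R = m1%:C * (1 + s / m1%:C).
    by rewrite mC mulrDr mulr1 mulrCA mulfV ?pnatr_eq0// mulr1 addrC.
  rewrite normcM normc_real gtr0_norm// ler_pM2l//.
  apply: le_trans (normc_1D_le _) _; rewrite ler_expR Re_div_real.
  rewrite normcM normcV normc_real gtr0_norm// lerD2l /c exprMn exprVn.
  by rewrite mulrAC.
apply: le_trans (ler_pM (normc_ge0 _) (normc_ge0 _) IHn step) _.
have fe : (n.+2)`!%:R = m1 * (n.+1)`!%:R by rewrite factS natrM.
rewrite fe; set F := (n.+1)`!%:R.
have F0 : 0 < F by rewrite ltr0n fact_gt0.
have -> : m `^ sg = m1 `^ sg * expR (sg * ln (m / m1)).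
  by rewrite /powR !gt_eqF// -expRD -mulrDr ln_div ?posrE// addrCA subrr addr0.
have P0 : 0 < K * F * m1 * m1 `^ sg 
  by rewrite mulr_gt0 ?powR_gt0// mulr_gt0// mulr_gt0.
rewrite [leLHS](_ : _ = K * F * m1 * m1 `^ sg * (expR (sg * ln (m / m1)) *
  expR (- (c / m)) * expR (sg / m1 + c / m1 ^+ 2))); last first.
  by move: (K) (F) => K' F'; ring.
rewrite [leRHS](_ : _ = K * F * m1 * m1 `^ sg * expR (- (c / m1))); last first.
  by move: (K) (F) => K' F'; ring.
rewrite ler_pM2l// -!expRD ler_expR.
clearbody m m1.
have l : ln (m / m1) <= - m1^-1.
  apply: le_trans (ln_le_subr1 (divr_gt0 m0 m10)) _.
  rewrite le_eqVlt; apply/orP; left; apply/eqP.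
  by rewrite mm1; field; rewrite -mm1 gt_eqF.
have l2 : sg * ln (m / m1) <= - (sg / m1) by rewrite -mulrN ler_pM2l.
have l3 : c / m1 ^+ 2 <= c / m - c / m1.
  rewrite -mulrBr ler_wpM2l// (_ : m^-1 - m1^-1 = (m * m1)^-1); last first.
    by rewrite mm1; field; rewrite -mm1 !gt_eqF.
  rewrite lef_pV2 ?posrE ?mulr_gt0 ?exprn_gt0// expr2 ler_pM2r// mm1.
  by rewrite lerDl.
by lra.
Qed.

(** The terms of Euler's formula are bounded away from zero. *)
Lemma Gamma_int_neq0 (R : realType) (s : R[i]) : 0 < complex.Re s ->
  Gamma_int s != 0.
Proof.
move=> s0; apply/eqP => e; have h := Gamma_int_Euler s0.
rewrite e in h; have {}h := ccvg_norm0 h.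
have [K K0 hK] := pochhammer_normc_le s0.
have : K^-1 <= 0.
  rewrite -(cvg_lim (@Rhausdorff R) h); apply: limr_ge.
    by apply/cvg_ex; exists 0.
  apply: nearW => n.
  have pn : pochhammer s n.+2 != 0 by apply/pochhammer_neq0/Re_gt0_nonpos_int.
  rewrite normcM normcV normcM normc_cpow// natrC normc_real gtr0_norm; last first.
    by rewrite ltr0n fact_gt0.
  rewrite ler_pdivlMr ?normc_gt0// ler_pdivrMl//.
  by rewrite [_ `^ _ * _]mulrC; exact: hK.
by rewrite leNgt invr_gt0 K0.
Qed.

(** * The continued Gamma function and the k-Gamma function *)

Lemma Gamma_shift_gt0 (R : realType) (z : R[i]) : 0 < complex.Re z ->
  Gamma_shift z = 0.
Proof. by rewrite /Gamma_shift => ->. Qed.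

Lemma GammaE (R : realType) (z : R[i]) : 0 < complex.Re z -> Gamma z = Gamma_int z.
Proof.
by move=> z0; rewrite /Gamma Gamma_shift_gt0// pochhammer0 divr1 addr0.
Qed.

(** The recurrence in the left half-plane holds by definition: one step from
    [z] to [z + 1] uses up one unit of the shift. *)
Lemma Gamma_shift_succ (R : realType) (z : R[i]) : complex.Re z <= 0 ->
  Gamma_shift z = (Gamma_shift (z + 1)).+1.
Proof.
move=> z0; rewrite /Gamma_shift ltNge z0 /= ReD Re1.
case: ifPn => [z1|].
  by rewrite (@truncn_def _ _ 0%N)// oppr_ge0 z0/=; lra.
rewrite -leNgt => z1.
rewrite (@truncn_def _ (- complex.Re z) (Num.truncn (- (complex.Re z + 1))).+1)//.
have y0 : 0 <= - (complex.Re z + 1) by rewrite oppr_ge0.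
have /andP[h1 h2] := truncn_itv y0.
move: h1 h2; move: (Num.truncn _) => m; rewrite -!natr1.
by move: (m%:R : R) => y h1 h2; lra.
Qed.

Lemma Gamma_succ (R : realType) (z : R[i]) : ~ nonpos_int z ->
  Gamma (z + 1) = z * Gamma z.
Proof.
move=> nz; have [z0|z0] := ltP 0 (complex.Re z).
  rewrite !GammaE//; first exact: Gamma_int_succ.
  by rewrite ReD Re1 addr_gt0.
have zn : z != 0 by apply/eqP => e; apply: nz; exists 0%N; rewrite e oppr0.
rewrite /Gamma (Gamma_shift_succ z0) pochhammerSl invfM mulrCA mulVKf//.
by rewrite -natr1 addrA addrAC mulrC.
Qed.

Lemma nonpos_intD (R : realType) (z : R[i]) n :
  ~ nonpos_int z -> ~ nonpos_int (z + n%:R).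
Proof.
move=> nz [m e]; apply: nz; exists (m + n)%N.
by rewrite natrD opprD -e addrK.
Qed.

Lemma Gamma_pochhammer (R : realType) (z : R[i]) n : ~ nonpos_int z ->
  Gamma (z + n%:R) = pochhammer z n * Gamma z.
Proof.
move=> nz; elim: n => [|n IHn]; first by rewrite addr0 pochhammer0 mul1r.
rewrite -natr1 addrA Gamma_succ; last exact: nonpos_intD.
by rewrite IHn pochhammerS; ring.
Qed.

Lemma Gamma_neq0 (R : realType) (z : R[i]) : 0 < complex.Re z -> Gamma z != 0.
Proof. by move=> z0; rewrite GammaE// Gamma_int_neq0. Qed.

Lemma realC_neq0 (R : realType) (r : R) : r != 0 -> r%:C != 0.
Proof. by move=> r0; rewrite -(rmorph0 (real_complex R)) (inj_eq (@complexI _)). Qed.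

Lemma ccontinuous_gamma (R : realType) (s : R[i]) (t : R) : 0 < t ->
  ccontinuous_at t (fun u : R => cpow u s * (expR (- u))%:C).
Proof.
move=> t0; apply: ccontinuousM.
  exact: is_cderive_continuous (@is_cderive_cpow R t id 1 s t0 (is_derive_id t 1)).
split => /=; last exact: cst_continuous.
apply: (@continuous_comp _ _ _ -%R expR); first exact: opp_continuous.
exact: continuous_expR.
Qed.

(** The substitution [u = t ^ k / k], with inverse [t = (k u) ^ (1 / k)]. *)
Lemma Gammak_int (R : realType) (k : R) (z : R[i]) : 0 < k -> 0 < complex.Re z ->
  cintegral `]0, +oo[
    (fun t : R => cpow t (z - 1) * (expR (- ((t `^ k) / k)))%:C) =
  cpow k (z / k%:C - 1) * Gamma_int (z / k%:C).
Proof.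
move=> k0 z0; set s := z / k%:C.
have kn : k != 0 by rewrite gt_eqF.
have knC := realC_neq0 kn.
have s0 : 0 < complex.Re s by rewrite Re_div_real divr_gt0.
have cint t : (`]0, +oo[%classic : set R) t <-> 0 < t.
  by rewrite /= in_itv/= andbT.
have [] := @csubstitution_exhausts R `]0, +oo[ `]0, +oo[ _ _
  (fun t => t `^ k / k) (fun u => (k * u) `^ k^-1) (fun t => t `^ (k - 1))
  (fun u : R => cpow u (s - 1) * (expR (- u))%:C) (exhausts_itv0y R).
- by move=> t /cint t0; apply/cint; rewrite divr_gt0// powR_gt0.
- by move=> t /cint t0; apply/cint; rewrite powR_gt0// mulr_gt0.
- move=> t /cint t0; rewrite mulrC divfK// -powRrM mulfV// powRr1//.
  exact: ltW.
- move=> t /cint t0; rewrite -powRrM mulVf// powRr1 ?mulr_ge0 ?ltW//.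
  by rewrite mulrC mulKf.
- by move=> a b u /cint a0 _ /andP[au _]; apply/cint; exact: lt_le_trans au.
- move=> a b /set_mem/cint a0 /set_mem/cint b0 ab.
  rewrite ltr_pM2r ?invr_gt0//.
  by apply: gt0_ltr_powR => //; rewrite nnegrE ltW.
- exact: interval_open.
- move=> t /cint t0; rewrite (_ : (fun t => _) = (fun u : R => k^-1 * u `^ k)).
    apply: (is_derive_eq (is_deriveZ k^-1 (is_derive_powR_id k t0))).
    by rewrite /GRing.scale /= mulKf.
  by apply/funext => u; rewrite mulrC.
- move=> t /cint t0; apply/differentiable_continuous/derivable1_diffP.
  by case: (is_derive_powR_id (k - 1) t0).
- by move=> t _; exact: powR_ge0.
- by move=> u /cint; exact: ccontinuous_gamma.
- have mk : measurable_fun (setT : set R) (fun t : R => t `^ k / k).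
    by apply: measurable_funM => //; exact: measurable_powR.
  apply: cmeasurableM; first apply: cmeasurableM.
  + by apply: cmeasurable_cpow; exact: measurable_funTS.
  + apply: cmeasurable_real; apply: measurable_funTS.
    apply: (measurableT_comp (@measurable_expR R)).
    exact: (measurableT_comp (@oppr_measurable R setT) mk).
  + by apply: cmeasurable_real; apply: measurable_funTS; exact: measurable_powR.
- exact: cintegrable_gamma.
move=> i; rewrite -/(Gamma_int s) => <-.
rewrite -cintegralZ//; apply: eq_cintegral => t /cint t0.
rewrite cpow_div ?powR_gt0// cpow_powR// -cpow_real//.
rewrite [RHS](_ : _ = (cpow t (k%:C * (s - 1)) * cpow t (k - 1)%:C) *
   (expR (- (t `^ k / k)))%:C * (cpow k (s - 1) / cpow k (s - 1))); last by ring.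
rewrite mulfV ?cpow_neq0// mulr1 -cpowD; congr (cpow t _ * _).
by rewrite /s rmorphB rmorph1 mulrBr mulrC divfK// mulr1; ring.
Qed.

Lemma GammakE (R : realType) (k : R) (z : R[i]) : 0 < k ->
  Gammak k z = cpow k (z / k%:C - 1) * Gamma (z / k%:C).
Proof.
move=> k0; rewrite /Gammak; case: ifPn => // z0.
by rewrite Gammak_int// GammaE// Re_div_real divr_gt0.
Qed.

(** * Absolutely convergent series *)

Lemma csummable_ccvg (R : realType) (u : nat -> R[i]) (K : R) :
  (forall n, \sum_(i < n) normc (u i) <= K) ->
  exists l, ccvg (fun n => \sum_(i < n) u i) l.
Proof.
move=> uK.
have key (h : R[i] -> R) : (forall z, `|h z| <= normc z) ->
    {morph h : x y / x + y} -> h 0 = 0 ->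
    cvgn (fun n => h (\sum_(i < n) u i)).
  move=> hn hD h0.
  have e n : h (\sum_(i < n) u i) = series (fun i => h (u i)) n.
    rewrite /series /= big_mkord; elim: n => [|n IHn]; first by rewrite !big_ord0.
    by rewrite !big_ord_recr /= hD IHn.
  under eq_fun do rewrite e.
  apply: normed_cvg.
  have -> : [normed series (fun i => h (u i))] = (fun n => \sum_(i < n) `|h (u i)|).
    by apply/funext => n; rewrite /normed_series_of /series /= big_mkord.
  apply: nondecreasing_is_cvgn.
    by apply/nondecreasing_seqP => n; rewrite big_ord_recr /= lerDl.
  exists K => _ [n _ <-].
  by apply: le_trans (uK n); apply: ler_sum => i _; exact: hn.
have /cvg_ex[/= a ra] := key (@complex.Re R) (@ler_Re_normc R) (@ReD R) erefl.
have /cvg_ex[/= b rb] := key (@complex.Im R) (@ler_Im_normc R) (@ImD R) erefl.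
by exists (a +i* b).
Qed.

(** Once the ratio is at most one half, the partial sum plus twice the next
    term no longer increases. *)
Lemma ratio_half_bounded (R : realType) (u : nat -> R) :
  (forall n, 0 <= u n) -> (\forall n \near \oo, u n.+1 <= u n / 2) ->
  exists2 K : R, 0 <= K & forall n, \sum_(i < n) u i <= K.
Proof.
move=> u0 [N _ hN].
pose V n := \sum_(i < n) u i + 2 * u n.
have V0 n : 0 <= V n by rewrite addr_ge0 ?sumr_ge0// mulr_ge0.
have hV n : V (N + n)%N <= V N.
  elim: n => [|n IHn]; first by rewrite addn0.
  apply: le_trans IHn; rewrite addnS /V big_ord_recr /=.
  have := hN (N + n)%N (leq_addr _ _).
  by move: (u (N + n).+1) (u (N + n)%N) (\sum_(i < _) _) => p q r; lra.
exists (V N) => // n; have [nN|Nn] := leqP n N.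
- apply: le_trans (_ : \sum_(i < N) u i <= _); last by rewrite lerDl mulr_ge0.
  rewrite -(subnKC nN) big_split_ord /= lerDl.
  by apply: sumr_ge0.
- have := hV (n - N)%N; rewrite subnKC ?(ltnW Nn)//; apply: le_trans.
  by rewrite lerDl mulr_ge0.
Qed.

Lemma hypergeometric_summable (R : realType) (b : R[i]) (w X : R) :
  ~ nonpos_int b -> 0 <= w -> 0 <= X ->
  exists2 K : R, 0 <= K & forall n,
    \sum_(i < n) w ^+ i / (normc (pochhammer b i) * i`!%:R) * X ^+ i <= K.
Proof.
move=> nb w0 X0; apply: (ratio_half_bounded (u := fun i =>
  w ^+ i / (normc (pochhammer b i) * i`!%:R) * X ^+ i)).
  by move=> n; rewrite !mulr_ge0 ?exprn_ge0 ?invr_ge0 ?mulr_ge0 ?normc_ge0.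
have bp n : 0 < normc (b + n%:R).
  apply: normc_gt0; apply/eqP => /eqP; rewrite addr_eq0 => /eqP e.
  by apply: nb; exists n.
have pp n : 0 < normc (pochhammer b n) by apply/normc_gt0/pochhammer_neq0.
(* From [N] on, [|b + n| >= 1]; from [M] on, [n + 1 >= 2 w X]. *)
pose N := (Num.truncn (1 - complex.Re b)).+1.
pose M := (Num.truncn (2 * (w * X))).+1.
exists (N + M)%N => // n /= nNM.
have h1 : 1 <= normc (b + n%:R).
  apply: le_trans (ler_Re_normc _); apply: le_trans (ler_norm _).
  rewrite ReD Re_nat -lerBlDl; apply: le_trans (ltW (truncnS_gt _)) _.
  by rewrite ler_nat (leq_trans _ nNM)// leq_addr.
have h2 : 2 * (w * X) <= n.+1%:R.
  apply: le_trans (ltW (truncnS_gt _)) _.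
  by rewrite ler_nat (leq_trans _ (leqnSn n))// (leq_trans _ nNM)// leq_addl.
have n0 : 0 < n.+1%:R :> R by [].
have f0 : 0 < n`!%:R :> R by rewrite ltr0n fact_gt0.
rewrite pochhammerS normcM factS natrM !exprS.
have -> : w * w ^+ n / (normc (pochhammer b n) * normc (b + n%:R) *
     (n.+1%:R * n`!%:R)) * (X * X ^+ n) = w ^+ n / (normc (pochhammer b n) * n`!%:R) * X ^+ n *
     (w * X / (normc (b + n%:R) * n.+1%:R)).
  rewrite !invfM; ring.
rewrite ler_wpM2l//.
  by rewrite !mulr_ge0 ?exprn_ge0 ?invr_ge0 ?mulr_ge0 ?normc_ge0.
rewrite ler_pdivrMr ?mulr_gt0//.
have : n.+1%:R <= normc (b + n%:R) * n.+1%:R by rewrite ler_peMl// ltW.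
by move: h2; move: (n.+1%:R : R) (normc _) => p q; nra.
Qed.

(** * Fractional integrals of power series *)

Lemma cpow_beta_scale (R : realType) (x t : R) (s a : R[i]) : 0 < x -> 0 < t < x ->
  cpow t (s - 1) * cpow (x - t) (a - 1) =
  cpow x (s + a - 1) / x%:C * (cpow (t / x) (s - 1) * cpow (1 - t / x) (a - 1)).
Proof.
move=> x0 /andP[t0 tx]; have xn : x != 0 by rewrite gt_eqF.
have -> : 1 - t / x = (x - t) / x by rewrite mulrBl mulfV.
rewrite !cpow_div ?subr_gt0//.
have -> : s + a - 1 = (s - 1) + (a - 1) + 1 by ring.
rewrite !cpowD cpow1//.
by field; rewrite realC_neq0// !cpow_neq0.
Qed.

Lemma cintegral_beta_scale (R : realType) (x : R) (s a : R[i]) : 0 < x ->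
  0 < complex.Re s -> 0 < complex.Re a ->
  cintegrable `]0, x[ (fun t : R => cpow t (s - 1) * cpow (x - t) (a - 1)) /\
  cintegral `]0, x[ (fun t : R => cpow t (s - 1) * cpow (x - t) (a - 1)) =
  cpow x (s + a - 1) * Beta s a.
Proof.
move=> x0 s0 a0; have xn : x != 0 by rewrite gt_eqF.
have mI : measurable `]0 : R, x[ by exact: measurable_itv.
have [i e] := cintegral_scale x0 (cmeasurable_beta (s - 1) (a - 1))
  (@itv01_ccontinuous_beta R (s - 1) (a - 1)) (cintegrable_beta s0 a0).
have eqf t : (`]0, x[%classic : set R) t -> 
   cpow x (s + a - 1) / x%:C * (cpow (t / x) (s - 1) * cpow (1 - t / x) (a - 1)) =
   cpow t (s - 1) * cpow (x - t) (a - 1).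
  by rewrite /= in_itv/= => tx; rewrite -cpow_beta_scale.
split.
  by apply: (eq_cintegrable mI eqf); exact: cintegrableZ.
transitivity (cintegral `]0, x[ (fun t : R => cpow x (s + a - 1) / x%:C *
    (cpow (t / x) (s - 1) * cpow (1 - t / x) (a - 1)))).
  by apply: eq_cintegral => t tD; rewrite eqf.
rewrite (cintegralZ _ mI i) /Beta.
rewrite [X in _ * X = _]e mulrA divfK//; exact: realC_neq0.
Qed.

Lemma beta_scale_integrable (R : realType) (x a b : R) : 0 < x ->
  0 < a -> 0 < b ->
  (@lebesgue_measure R).-integrable `]0, x[
    (EFin \o (fun t : R => t `^ (b - 1) * (x - t) `^ (a - 1))).
Proof.
move=> x0 a0 b0; have [[h _] _] := @cintegral_beta_scale R x b%:C a%:C x0 b0 a0.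
move: h; apply: eq_integrable => // t tD.
have /andP[t0 tx] : 0 < t < x by move: tD; rewrite inE /= in_itv.
have e (c : R) : c%:C - 1 = (c - 1)%:C by rewrite rmorphB rmorph1.
by rewrite /comp; congr EFin; rewrite !e !cpow_real ?subr_gt0// -rmorphM.
Qed.

(** The duplication of Pochhammer symbols that turns the single pair of
    parameters [mu] and [mu + alpha] into two pairs of halves. *)
Lemma pochhammer_double (R : realType) (a : R[i]) n :
  pochhammer a (2 * n) =
  4 ^+ n * (pochhammer (a / 2) n * pochhammer (a / 2 + 1 / 2) n).
Proof.
elim: n => [|n IHn]; first by rewrite muln0 !pochhammer0 !mulr1.
rewrite mulnS !pochhammerS IHn exprS -natr1 natrM.
by field.
Qed.

Lemma Beta_pochhammer (R : realType) (s a : R[i]) n :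
  0 < complex.Re s -> 0 < complex.Re a ->
  Beta (s + n%:R) a = pochhammer s n / pochhammer (s + a) n
    * (Gamma s * Gamma a / Gamma (s + a)).
Proof.
move=> s0 a0.
have sn0 : 0 < complex.Re (s + n%:R) by rewrite ReD Re_nat ltr_wpDr.
have sa0 : 0 < complex.Re (s + a) by rewrite ReD addr_gt0.
have san0 : 0 < complex.Re (s + a + n%:R) by rewrite ReD Re_nat ltr_wpDr.
have g := Gamma_neq0 san0.
have := Beta_Gamma sn0 a0; rewrite addrAC -!GammaE// => e.
apply: (mulIf g); rewrite e !Gamma_pochhammer//; try exact: Re_gt0_nonpos_int.
have p : pochhammer (s + a) n != 0 by apply/pochhammer_neq0/Re_gt0_nonpos_int.
by field; rewrite p Gamma_neq0.
Qed.

(** Dominated convergence: the partial sums are bounded by [K] on the whole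
    interval, and each monomial gives a Beta integral. *)
Lemma cintegral_power_series (R : realType) (x K : R) (a s : R[i])
    (r : nat -> R[i]) (S : R -> R[i]) :
  0 < x -> 0 < complex.Re a -> 0 < complex.Re s ->
  (forall n, \sum_(i < n) normc (r i) * x ^+ (2 * i) <= K) ->
  (forall t, 0 < t < x -> ccvg (fun n => \sum_(i < n) r i * t%:C ^+ (2 * i)) (S t)) ->
  cintegrable `]0, x[ (fun t => cpow t (s - 1) * cpow (x - t) (a - 1) * S t) /\
  ccvg (fun n => \sum_(i < n) r i * (cpow x (s + (2 * i)%:R + a - 1)
          * Beta (s + (2 * i)%:R) a))
    (cintegral `]0, x[ (fun t => cpow t (s - 1) * cpow (x - t) (a - 1) * S t)).
Proof.
move=> x0 a0 s0 rK rS.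
have mI : measurable `]0 : R, x[ by exact: measurable_itv.
have ms : cmeasurable `]0, x[ (fun t : R => cpow t (s - 1) * cpow (x - t) (a - 1)).
  by apply: cmeasurableM; apply: cmeasurable_cpow => //; exact: measurable_funB.
pose u n t := \sum_(i < n) r i * (cpow t (s - 1) * cpow (x - t) (a - 1)
  * t%:C ^+ (2 * i)).
have uE n t : u n t = cpow t (s - 1) * cpow (x - t) (a - 1) *
    \sum_(i < n) r i * t%:C ^+ (2 * i).
  by rewrite mulr_sumr; apply: eq_bigr => i _; rewrite mulrCA.
have gi : (@lebesgue_measure R).-integrable `]0, x[
    (EFin \o (fun t : R => K * (t `^ (complex.Re s - 1) * (x - t) `^ (complex.Re a - 1)))).
  have := @integrableZl _ _ R lebesgue_measure _ mI K _ (beta_scale_integrable x0 a0 s0).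
  by [].
have ui i : cintegrable `]0, x[ (fun t : R => cpow t (s - 1) * cpow (x - t) (a - 1)
    * t%:C ^+ (2 * i)) /\
  cintegral `]0, x[ (fun t : R => cpow t (s - 1) * cpow (x - t) (a - 1)
    * t%:C ^+ (2 * i)) = cpow x (s + (2 * i)%:R + a - 1) * Beta (s + (2 * i)%:R) a.
  have si0 : 0 < complex.Re (s + (2 * i)%:R) by rewrite ReD Re_nat ltr_wpDr.
  have [h1 h2] := cintegral_beta_scale x0 si0 a0.
  have e t : (`]0, x[%classic : set R) t ->
     cpow t (s + (2 * i)%:R - 1) * cpow (x - t) (a - 1) =
     cpow t (s - 1) * cpow (x - t) (a - 1) * t%:C ^+ (2 * i).
    rewrite [X in X -> _]/= in_itv/= => /andP[t0 _].
    by rewrite addrAC cpowDn// mulrAC.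
  by rewrite -(eq_cintegral e); split => //; apply: eq_cintegrable h1.
have ri i : cintegrable `]0, x[ (fun t : R => r i * (cpow t (s - 1) * cpow (x - t) (a - 1)
    * t%:C ^+ (2 * i))).
  by apply: cintegrableZ => //; case: (ui i).
have [|||h1 h2] := @cdominated_convergence R `]0, x[ u
  (fun t => cpow t (s - 1) * cpow (x - t) (a - 1) * S t) _ mI _ _ _ gi.
- move=> n; apply: (@cmeasurable_sum R _ (fun i t => r i * (cpow t (s - 1) *
    cpow (x - t) (a - 1) * t%:C ^+ (2 * i)))) => i.
  apply: cmeasurableM; first exact: cmeasurable_cst.
  apply: cmeasurableM => //.
  have -> : (fun t : R => t%:C ^+ (2 * i)) = (fun t => (t ^+ (2 * i))%:C).
    by apply/funext => t; rewrite rmorphXn.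
  by apply: cmeasurable_real; exact: measurable_funX.
- move=> t; rewrite [X in X -> _]/= in_itv/= => tx.
  have := ccvgM (ccvg_cst (cpow t (s - 1) * cpow (x - t) (a - 1))) (rS t tx).
  by apply: ccvg_eq => n; rewrite uE.
- move=> n t; rewrite [X in X -> _]/= in_itv/= => /andP[t0 tx].
  rewrite uE normcM normcM !normc_cpow ?subr_gt0// !ReB1 mulrC.
  rewrite ler_wpM2r ?mulr_ge0 ?powR_ge0//.
  apply: le_trans (normc_sum (fun i => r i * t%:C ^+ (2 * i)) n) _.
  apply: le_trans (rK n); apply: ler_sum => i _.
  rewrite normcM normcX normc_real gtr0_norm// ler_wpM2l ?normc_ge0//.
  by rewrite lerXn2r ?nnegrE ?ltW.
split => //; apply: ccvg_eq h2 => n.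
rewrite /u (cintegral_sum (f := fun i t => r i * (cpow t (s - 1) *
    cpow (x - t) (a - 1) * t%:C ^+ (2 * i))))//.
apply: eq_bigr => i _; have [h3 h4] := ui i.
by rewrite cintegralZ// h4.
Qed.

(** * The k-Bessel series *)

(** The coefficients of the hypergeometric series of type (0, 1) with lower
    parameter [b], in the variable [w t ^ 2]. *)
Definition bessel_coef (R : realType) (w b : R[i]) (n : nat) : R[i] :=
  w ^+ n / (pochhammer b n * n`!%:R).

Lemma bessel_coef_summable (R : realType) (w b : R[i]) (t : R) :
  ~ nonpos_int b -> 0 <= t ->
  exists2 K : R, 0 <= K & forall n,
    \sum_(i < n) normc (bessel_coef w b i) * t ^+ (2 * i) <= K.
Proof.
move=> nb t0; have [K K0 hK] := @hypergeometric_summable R b (normc w) (t ^+ 2)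
  nb (normc_ge0 w) (sqr_ge0 t).
exists K => // n; apply: le_trans (hK n).
rewrite le_eqVlt; apply/orP; left; apply/eqP; apply: eq_bigr => i _.
rewrite /bessel_coef normcM normcV normcM normcX natrC normc_real exprM.
by rewrite ger0_norm.
Qed.

Lemma bessel_coef_ccvg (R : realType) (w b : R[i]) (t : R) :
  ~ nonpos_int b -> 0 <= t ->
  exists l, ccvg (fun n => \sum_(i < n) bessel_coef w b i * t%:C ^+ (2 * i)) l.
Proof.
move=> nb t0; have [K _ hK] := bessel_coef_summable w nb t0.
apply: (csummable_ccvg (u := fun i => bessel_coef w b i * t%:C ^+ (2 * i)) (K := K)) => n.
apply: le_trans (hK n); rewrite le_eqVlt; apply/orP; left; apply/eqP.
by apply: eq_bigr => i _; rewrite normcM normcX normc_real ger0_norm.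
Qed.

(** For [nu = v / k], the k-Gamma function at [n k + v + k] is
    [k ^ (n + nu) Gamma (nu + 1 + n)], and
    [Gamma (nu + 1 + n) = (nu + 1)_n Gamma (nu + 1)]. *)
Lemma kBessel_termE (R : realType) (k c : R) (v : R[i]) (t : R) n :
  0 < k -> 0 < t -> ~ nonpos_int (v / k%:C + 1) ->
  kBessel_term k c v t n =
  (cpow k (v / k%:C) * Gamma (v / k%:C + 1))^-1 * cpow (t / 2) (v / k%:C) *
  (bessel_coef (- c%:C / (4 * k%:C)) (v / k%:C + 1) n * t%:C ^+ (2 * n)).
Proof.
move=> k0 t0 nb; have kn : k%:C != 0 by apply: realC_neq0; rewrite gt_eqF.
rewrite /kBessel_term GammakE//; set nu := v / k%:C.
have -> : (n%:R * k%:C + v + k%:C) / k%:C = nu + 1 + n%:R.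
  by rewrite /nu; field.
rewrite Gamma_pochhammer//.
have -> : nu + 1 + n%:R - 1 = nu + n%:R by ring.
rewrite cpowDn// [_ + nu]addrC cpowDn ?divr_gt0// /bessel_coef.
have -> : (t / 2)%:C = t%:C / 2 by rewrite rmorphM fmorphV rmorph_nat.
have pn := pochhammer_neq0 n nb.
have e4 : (2 : R[i]) ^+ (2 * n) = 4 ^+ n.
  by rewrite exprM; congr (_ ^+ _); ring.
rewrite !expr_div_n exprMn e4.
rewrite !invfM; ring.
Qed.

Theorem corollary3p2 (R : realType) (k c x : R) (alpha lambda v : R[i])
  (hk : 0 < k) (hx : 0 < x)
  (hv : -1 < complex.Re v)
  (halpha : 0 < complex.Re alpha)
  (hlv : 0 < complex.Re (lambda + v))
  (hpole : ~ nonpos_int (lambda / k%:C + v / k%:C))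
  (hb1 : ~ nonpos_int (v / k%:C + 1))
  (hb2 : ~ nonpos_int (lambda / (2 * k%:C) + v / (2 * k%:C) + alpha / 2))
  (hb3 : ~ nonpos_int (lambda / (2 * k%:C) + v / (2 * k%:C) + (alpha + 1) / 2)) :
  let f := fun t : R => cpow t (lambda / k%:C - 1) * kBessel k c v t in
  let a := [:: lambda / (2 * k%:C) + v / (2 * k%:C);
               lambda / (2 * k%:C) + v / (2 * k%:C) + 1 / 2] in
  let b := [:: v / k%:C + 1;
               lambda / (2 * k%:C) + v / (2 * k%:C) + alpha / 2;
               lambda / (2 * k%:C) + v / (2 * k%:C) + (alpha + 1) / 2] in
  let z := - (c%:C * x%:C ^+ 2 / (4 * k%:C)) in
  [/\ forall t : R, 0 < t -> cseries_cvg (kBessel_term k c v t),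
      cintegrable `]0, x[ (RL_integrand alpha f x),
      cseries_cvg (pFq_term a b z)
    & RL_integral alpha f x =
      cpow x (lambda / k%:C + v / k%:C + alpha - 1) / cpow (2 * k) (v / k%:C)
      * (Gamma (lambda / k%:C + v / k%:C)
         / (Gamma (lambda / k%:C + v / k%:C + alpha) * Gamma (v / k%:C + 1)))
      * pFq a b z].
Proof.
move=> f a b z.
have kn : k%:C != 0 by apply: realC_neq0; rewrite gt_eqF.
have mI : measurable `]0 : R, x[ by exact: measurable_itv.
pose nu := v / k%:C; pose mu := lambda / k%:C + nu.
pose r := bessel_coef (- c%:C / (4 * k%:C)) (nu + 1).
pose E := (cpow k nu * Gamma (nu + 1))^-1.
have mu0 : 0 < complex.Re mu.
  by rewrite /mu /nu -mulrDl Re_div_real divr_gt0.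
have mua0 : 0 < complex.Re (mu + alpha) by rewrite ReD addr_gt0.
have /choice[S hS] : forall t : R, exists l, 0 < t ->
    ccvg (fun n => \sum_(i < n) r i * t%:C ^+ (2 * i)) l.
  move=> t; have [t0|t0] := ltP 0 t; last by exists 0.
  have [l hl] := bessel_coef_ccvg (- c%:C / (4 * k%:C)) hb1 (ltW t0).
  by exists l.
have hW t : 0 < t -> cseries_cvg (kBessel_term k c v t) /\
    kBessel k c v t = E * cpow (t / 2) nu * S t.
  move=> t0; apply: cseries_cvgE.
  have := ccvgM (ccvg_cst (E * cpow (t / 2) nu)) (hS t t0).
  apply: ccvg_eq => n; rewrite mulr_sumr; apply: eq_bigr => i _.
  by rewrite kBessel_termE.
have [K _ hK] := bessel_coef_summable (- c%:C / (4 * k%:C)) hb1 (ltW hx).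
have [|Gi Gc] := cintegral_power_series hx halpha mu0 hK (S := S).
  by move=> t /andP[t0 _]; exact: hS.
pose G t := cpow t (mu - 1) * cpow (x - t) (alpha - 1) * S t.
have {}Gi : cintegrable `]0, x[ G := Gi.
have fE t : (`]0, x[%classic : set R) t ->
    E / cpow 2 nu * G t = RL_integrand alpha f x t.
  rewrite [X in X -> _]/= in_itv/= => /andP[t0 tx].
  rewrite /RL_integrand /f (hW t t0).2 /G cpow_div// /mu addrAC [cpow t (_ + nu)]cpowD.
  by ring.
(* Since [C] is nonzero, convergence of the integrated series implies
   convergence of the hypergeometric series. *)
pose C := cpow x (mu + alpha - 1) * (Gamma mu * Gamma alpha / Gamma (mu + alpha)).
have C0 : C != 0.
  apply: mulf_neq0 (cpow_neq0 _ _) _.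
  by apply: mulf_neq0 (invr_neq0 (Gamma_neq0 mua0)); apply: mulf_neq0; exact: Gamma_neq0.
have termE i : r i * (cpow x (mu + (2 * i)%:R + alpha - 1) * Beta (mu + (2 * i)%:R) alpha)
    = C * pFq_term a b z i.
  have -> : mu + (2 * i)%:R + alpha - 1 = mu + alpha - 1 + (2 * i)%:R by ring.
  rewrite cpowDn// Beta_pochhammer// !pochhammer_double /pFq_term /a /b.
  rewrite !big_cons !big_nil !mulr1.
  have e1 : lambda / (2 * k%:C) + v / (2 * k%:C) = mu / 2.
    by rewrite /mu /nu; field.
  rewrite e1.
  have -> : mu / 2 + alpha / 2 = (mu + alpha) / 2 by field.
  have -> : mu / 2 + (alpha + 1) / 2 = (mu + alpha) / 2 + 1 / 2 by field.
  rewrite /r /bessel_coef -/nu.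
  have -> : z = - c%:C / (4 * k%:C) * x%:C ^+ 2 by rewrite /z; field.
  have f4 : (4 : R[i]) ^+ i / 4 ^+ i = 1 by rewrite mulfV// expf_neq0// pnatr_eq0.
  set w := - c%:C / (4 * k%:C); rewrite [(w * _) ^+ _]exprMn -exprM.
  rewrite -(mulf_div (4 ^+ i) (4 ^+ i)) f4 mul1r /C.
  move: (Gamma mu) (Gamma alpha) (Gamma (mu + alpha)) (w ^+ i).
  by move=> g1 g2 g3 p; rewrite !invfM; ring.
have hF : ccvg (fun n => \sum_(i < n) pFq_term a b z i) (C^-1 * cintegral `]0, x[ G).
  have := ccvgM (ccvg_cst C^-1) Gc; apply: ccvg_eq => n.
  by rewrite mulr_sumr; apply: eq_bigr => i _; rewrite termE mulKf.
have [pc ps] := cseries_cvgE hF.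
split.
- by move=> t /hW[].
- by apply: (eq_cintegrable mI fE); exact: cintegrableZ.
- exact: pc.
rewrite /RL_integral -(eq_cintegral fE) cintegralZ// /pFq ps.
rewrite cpowM// -/nu -/mu /E /C.
have := Gamma_neq0 halpha; have := Gamma_neq0 mu0; have := Gamma_neq0 mua0.
have := cpow_neq0 x (mu + alpha - 1).
move: (cintegral _ _) (Gamma mu) (Gamma alpha) (Gamma (mu + alpha)).
move: (Gamma (nu + 1)) (cpow x _) (cpow 2 nu) (cpow k nu).
move=> g p p2 pk I g1 g2 g3 n4 n3 n2 n1.
rewrite !invfM; move: g^-1 p2^-1 pk^-1 => g' p2' pk'.
by field; rewrite n1 n2 n3 n4.
Qed.
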